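(* Let $\kappa\ge\omega_2$ and let $S\subseteq[\kappa]^\omega$ be stationary. Then $S$ is spanning if and only if the forcing $P_S$ is semiproper.
   Context: $[\kappa]^\omega$ is the set of countable subsets of $\kappa$; club and stationary are as usual. Only $x$ with $\delta_x:=x\cap\omega_1$ a countable ordinal are considered. $y$ is an $\omega_1$-extension of $x$ if $x\subseteq y$ and $\delta_x=\delta_y$. $S$ is spanning if for every cardinal $\lambda\ge\kappa$ and every club $C$ in $[\lambda]^\omega$ there is a club $D$ in $[\lambda]^\omega$ such that every $x\in D$ has an $\omega_1$-extension $y\in C$ with $y\cap\kappa\in S$. $P_S$ is the forcing whose conditions are sequences $\langle x_\alpha:\alpha\le\gamma\rangle$, $\gamma<\omega_1$, with each $x_\alpha\in S$, increasing under inclusion, continuous ($x_\alpha=\bigcup_{\beta<\alpha}x_\beta$ for limit $\alpha$), and $\delta_{x_\alpha}<\delta_{x_\beta}$ for $\alpha<\beta\le\gamma$; ordered by end-extension. Semiproper: for a forcing $P$ with $|P|\ge\aleph_1$ and $\lambda\ge|P|^+$, consider countable elementary submodels $M$ of $(H_\lambda,\in,<,P,\Vdash_P)$ ($<$ a fixed well-ordering). $q$ is semigeneric for $M$ if for every $P$-name $\dot\alpha\in M$ for a countable ordinal there is $\beta\in M$ with $q\Vdash\dot\alpha=\beta$. $P$ is semiproper if (for all such $\lambda$) the set $\{M:\forall p\in M\cap P\,\exists q\le p\ q\text{ semigeneric for }M\}$ contains a club. *)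

(* Defs.v *)
From Stdlib Require Import Classical ClassicalEpsilon FunctionalExtensionality
  PropExtensionality ProofIrrelevance Relations.

(** * The universe of sets

    [V] is the type of well-founded trees (Aczel's sets) modulo bisimilarity.
    With classical logic and choice it satisfies ZFC, with full second-order
    separation and replacement.  Classes are predicates [V -> Prop]; every
    subclass of a set is a set, so families of subsets of a set are given
    directly as predicates. *)

Inductive pset : Type := Sup (A : Type) (f : A -> pset).

Fixpoint bisim (s t : pset) : Prop :=
  match s, t with
  | Sup A f, Sup B g =>
      (forall a, exists b, bisim (f a) (g b)) /\
      (forall b, exists a, bisim (f a) (g b))
  end.

Lemma bisim_refl s : bisim s s.
Proof. induction s as [A f IH]; split; intros a; exists a; apply IH. Qed.

Lemma bisim_sym s t : bisim s t -> bisim t s.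
Proof.
  revert t; induction s as [A f IH]; intros [B g] [H1 H2]; split.
  - intros b; destruct (H2 b) as [a Ha]; exists a; auto.
  - intros a; destruct (H1 a) as [b Hb]; exists b; auto.
Qed.

Lemma bisim_trans s t u : bisim s t -> bisim t u -> bisim s u.
Proof.
  revert t u; induction s as [A f IH].
  intros [B g] [C h] [H1 H2] [K1 K2]; split.
  - intros a; destruct (H1 a) as [b Hb]; destruct (K1 b) as [c Hc].
    exists c; eauto.
  - intros c; destruct (K2 c) as [b Hb]; destruct (H2 b) as [a Ha].
    exists a; eauto.
Qed.

Definition V : Type := {c : pset -> Prop | exists t, c = bisim t}.

Definition cls (t : pset) : V := exist _ (bisim t) (ex_intro _ t eq_refl).

Lemma cls_eq s t : cls s = cls t <-> bisim s t.
Proof.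
  split.
  - intros H; apply (f_equal (@proj1_sig _ _)) in H; simpl in H.
    rewrite H; apply bisim_refl.
  - intros H; apply subset_eq_compat.
    apply functional_extensionality; intros u.
    apply propositional_extensionality; split; intros K.
    + apply bisim_trans with s; [apply bisim_sym|]; assumption.
    + apply bisim_trans with t; assumption.
Qed.

Lemma cls_surj (x : V) : exists t, x = cls t.
Proof. destruct x as [c [t ->]]; exists t; reflexivity. Qed.

Definition mem (x y : V) : Prop :=
  exists (A : Type) (f : A -> pset) (a : A), y = cls (Sup A f) /\ x = cls (f a).

Infix "∈" := mem (at level 70).

Definition elts (y : V) : V -> Prop := fun z => z ∈ y.
Definition incl (x y : V) : Prop := forall z, z ∈ x -> z ∈ y.

Infix "⊆" := incl (at level 70).

Lemma mem_cls x A f : x ∈ cls (Sup A f) <-> exists a, x = cls (f a).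
Proof.
  split.
  - intros (B & g & b & H & ->).
    apply cls_eq in H; destruct H as [_ H]; destruct (H b) as [a Ha].
    exists a; apply cls_eq, bisim_sym, Ha.
  - intros [a ->]; exists A, f, a; auto.
Qed.

Lemma set_ext x y : (forall z, z ∈ x <-> z ∈ y) -> x = y.
Proof.
  destruct (cls_surj x) as [[A f] ->], (cls_surj y) as [[B g] ->]; intros H.
  apply cls_eq; split.
  - intros a.
    assert (K : cls (f a) ∈ cls (Sup B g)) by (apply H, mem_cls; eauto).
    apply mem_cls in K; destruct K as [b K]; exists b; apply cls_eq, K.
  - intros b.
    assert (K : cls (g b) ∈ cls (Sup A f)) by (apply H, mem_cls; eauto).
    apply mem_cls in K; destruct K as [a K]; exists a; apply cls_eq; auto.
Qed.

Lemma mem_wf : well_founded mem.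
Proof.
  intros x; destruct (cls_surj x) as [t ->].
  induction t as [A f IH]; constructor; intros y Hy.
  apply mem_cls in Hy; destruct Hy as [a ->]; apply IH.
Qed.

Definition rep (x : V) : pset :=
  proj1_sig (constructive_indefinite_description _ (cls_surj x)).

Lemma cls_rep x : cls (rep x) = x.
Proof.
  unfold rep; destruct (constructive_indefinite_description _ _) as [t H].
  simpl; auto.
Qed.

Definition range {A : Type} (f : A -> V) : V := cls (Sup A (fun a => rep (f a))).

Lemma mem_range A (f : A -> V) x : x ∈ range f <-> exists a, x = f a.
Proof.
  unfold range; rewrite mem_cls; split; intros [a ->]; exists a;
    rewrite cls_rep; reflexivity.
Qed.

Definition small (p : V -> Prop) : Prop :=
  exists (A : Type) (f : A -> V), forall z, p z -> exists a, z = f a.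

(** [setof p] is junk when [p] is a proper class. *)
Definition setof (p : V -> Prop) : V :=
  epsilon (inhabits (range (fun e : False => match e with end)))
    (fun y => forall z, z ∈ y <-> p z).

Lemma mem_setof p : small p -> forall z, z ∈ setof p <-> p z.
Proof.
  intros (A & f & H).
  apply (epsilon_spec _ (fun y => forall z, z ∈ y <-> p z)).
  exists (range (fun a : {a : A | p (f a)} => f (proj1_sig a))).
  intros z; rewrite mem_range; split.
  - intros [[a Ha] ->]; exact Ha.
  - intros Hz; destruct (H z Hz) as [a ->]; exists (exist _ a Hz); reflexivity.
Qed.

Lemma small_elts x : small (elts x).
Proof.
  destruct (cls_surj x) as [[A f] ->].
  exists A, (fun a => cls (f a)); intros z Hz; apply mem_cls, Hz.
Qed.

Lemma small_sub (p q : V -> Prop) : (forall z, p z -> q z) -> small q -> small p.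
Proof. intros H (A & f & K); exists A, f; auto. Qed.

Definition cap (x y : V) : V := setof (fun z => z ∈ x /\ z ∈ y).

Lemma mem_cap x y z : z ∈ cap x y <-> z ∈ x /\ z ∈ y.
Proof.
  apply mem_setof; apply small_sub with (elts x); [|apply small_elts].
  intros u [H _]; exact H.
Qed.

Definition upair (x y : V) : V := range (fun b : bool => if b then x else y).

Definition pair (x y : V) : V := upair (upair x x) (upair x y).

(** * Ordinals and cardinals

    By replacement and separation, maps between sets may be taken to be
    arbitrary functions at the level of the type theory. *)

Definition inj_on {B : Type} (A : V -> Prop) (f : V -> B) : Prop :=
  forall x y, A x -> A y -> f x = f y -> x = y.

Definition equinum (A B : V -> Prop) : Prop :=
  exists f : V -> V, (forall x, A x -> B (f x)) /\ inj_on A f /\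
    (forall y, B y -> exists x, A x /\ f x = y).

Definition countable (A : V -> Prop) : Prop := exists f : V -> nat, inj_on A f.

Definition transitive (x : V) : Prop := forall y, y ∈ x -> y ⊆ x.

Definition ordinal (x : V) : Prop :=
  transitive x /\ forall y, y ∈ x -> transitive y.

Definition cardinal (k : V) : Prop :=
  ordinal k /\ forall a, a ∈ k -> ~ equinum (elts a) (elts k).

Definition cardinality (A : V -> Prop) (mu : V) : Prop :=
  cardinal mu /\ equinum A (elts mu).

Definition card_succ (mu nu : V) : Prop :=
  cardinal nu /\ mu ∈ nu /\ forall rho, cardinal rho -> mu ∈ rho -> nu ⊆ rho.

Definition countable_ordinal (x : V) : Prop := ordinal x /\ countable (elts x).

Definition omega1 : V := setof countable_ordinal.

Lemma ordinal_mem x y : ordinal x -> y ∈ x -> ordinal y.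
Proof.
  intros [T H] Hy; split; [apply H, Hy|].
  intros z Hz; apply H, (T y Hy z Hz).
Qed.

Lemma mem_omega1 x : x ∈ omega1 <-> countable_ordinal x.
Proof.
  revert x; apply mem_setof.
  pose (codes (R : nat -> nat -> Prop) (D : nat -> Prop) (x : V) :=
    countable_ordinal x /\ exists f : V -> nat, inj_on (elts x) f /\
      (forall n, D n <-> exists y, y ∈ x /\ f y = n) /\
      (forall y z, y ∈ x -> z ∈ x -> (R (f y) (f z) <-> y ∈ z))).
  assert (uniq : forall R D x x', codes R D x -> codes R D x' -> x = x').
  { intros R D x x' [[[Tx _] _] (f & If & Df & Rf)]
      [[[Tx' _] _] (g & Ig & Dg & Rg)].
    assert (K : forall y, y ∈ x -> forall y', y' ∈ x' -> f y = g y' -> y = y').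
    { intros y; induction (mem_wf y) as [y _ IH]; intros Hy y' Hy' E.
      apply set_ext; intros z; split; intros Hz.
      - assert (Zx : z ∈ x) by (apply (Tx y Hy z Hz)).
        destruct (proj1 (Dg (f z))) as (z' & Hz' & Ez).
        { apply Df; exists z; auto. }
        rewrite (IH z Hz Zx z' Hz' (eq_sym Ez)).
        apply Rg; auto; rewrite Ez, <- E; apply Rf; auto.
      - assert (Zx : z ∈ x') by (apply (Tx' y' Hy' z Hz)).
        destruct (proj1 (Df (g z))) as (w & Hw & Ew).
        { apply Dg; exists z; auto. }
        assert (Hwy : w ∈ y).
        { apply Rf; auto; rewrite Ew, E; apply Rg; auto. }
        rewrite <- (IH w Hwy Hw z Zx Ew); exact Hwy. }
    apply set_ext; intros z; split; intros Hz.
    - destruct (proj1 (Dg (f z))) as (z' & Hz' & Ez).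
      { apply Df; exists z; auto. }
      rewrite (K z Hz z' Hz' (eq_sym Ez)); exact Hz'.
    - destruct (proj1 (Df (g z))) as (w & Hw & Ew).
      { apply Dg; exists z; auto. }
      rewrite <- (K w Hw z Hz Ew); exact Hw. }
  exists ((nat -> nat -> Prop) * (nat -> Prop))%type.
  exists (fun c => epsilon (inhabits (range (fun e : False => match e with end)))
                    (codes (fst c) (snd c))).
  intros x Hx; destruct (Hx) as [_ [f If]].
  exists (fun m n => exists y z, y ∈ x /\ z ∈ x /\ f y = m /\ f z = n /\ y ∈ z,
     fun n => exists y, y ∈ x /\ f y = n); simpl.
  match goal with |- x = epsilon _ (codes ?R ?D) =>
    assert (Hc : codes R D x); [|apply (uniq R D); [exact Hc|]] end.
  - split; [exact Hx|]; exists f; split; [exact If|]; split; [reflexivity|].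
    intros y z Hy Hz; split; [|intros; exists y, z; auto].
    intros (y' & z' & Hy' & Hz' & Ey & Ez & H).
    rewrite <- (If y' y Hy' Hy Ey), <- (If z' z Hz' Hz Ez); exact H.
  - apply epsilon_spec; exists x; exact Hc.
Qed.

(** * Clubs, stationary sets, spanning sets *)

Definition delta (x : V) : V := cap x omega1.

(** [ctbl A] is the set of at most countable subsets [x] of [A] for which
    [delta x] is a countable ordinal.  The latter sets form a club among all
    countable subsets of [A], so restricting to them from the outset does not
    affect what contains a club and what is stationary. *)
Definition ctbl (A : V -> Prop) (x : V) : Prop :=
  (forall z, z ∈ x -> A z) /\ countable (elts x) /\ delta x ∈ omega1.

Definition is_union (u : V) (f : nat -> V) : Prop :=
  forall z, z ∈ u <-> exists n, z ∈ f n.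

Definition club (A : V -> Prop) (C : V -> Prop) : Prop :=
  (forall x, C x -> ctbl A x) /\
  (forall x, ctbl A x -> exists y, C y /\ x ⊆ y) /\
  (forall (f : nat -> V) (u : V), (forall n, C (f n)) ->
     (forall n, f n ⊆ f (S n)) -> is_union u f -> C u).

Definition stationary (A : V -> Prop) (S : V -> Prop) : Prop :=
  (forall x, S x -> ctbl A x) /\
  (forall C, club A C -> exists x, C x /\ S x).

Definition omega1_extension (x y : V) : Prop := x ⊆ y /\ delta x = delta y.

Definition spanning (kappa : V) (S : V -> Prop) : Prop :=
  forall lambda, cardinal lambda -> kappa ⊆ lambda ->
  forall C, club (elts lambda) C ->
  exists D, club (elts lambda) D /\
    forall x, D x -> exists y, C y /\ omega1_extension x y /\ S (cap y kappa).

(** * Forcing *)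

Record forcing := Forcing { cond : V -> Prop; ext : V -> V -> Prop }.

(** [ext P q p] reads [q <= p]: [q] is stronger than [p]. *)

Inductive name (P : forcing) (tau : V) : Prop :=
| Name : (forall z, z ∈ tau ->
            exists sigma s, z = pair sigma s /\ name P sigma /\ cond P s) ->
         name P tau.

(** [p] forces [tau = sigma].  The usual recursion on names; since names are
    well-founded, the least relation satisfying the recursion is the only one. *)
Inductive forces_eq (P : forcing) (p tau sigma : V) : Prop :=
| ForcesEq :
    (forall pi s, pair pi s ∈ tau -> forall q, cond P q -> ext P q p ->
       exists r, cond P r /\ ext P r q /\
         (ext P r s -> exists pi' s', pair pi' s' ∈ sigma /\ ext P r s' /\
                         forces_eq P r pi pi')) ->
    (forall pi' s', pair pi' s' ∈ sigma -> forall q, cond P q -> ext P q p ->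
       exists r, cond P r /\ ext P r q /\
         (ext P r s' -> exists pi s, pair pi s ∈ tau /\ ext P r s /\
                         forces_eq P r pi pi')) ->
    forces_eq P p tau sigma.

Definition forces_in (P : forcing) (p tau sigma : V) : Prop :=
  forall q, cond P q -> ext P q p ->
    exists r, cond P r /\ ext P r q /\
      exists pi s, pair pi s ∈ sigma /\ ext P r s /\ forces_eq P r tau pi.

(** [is_check P x t]: [t] is the canonical name for [x], that is
    [t = {(y^, p) : y ∈ x, p a condition}].  All conditions are used because a
    forcing need not have a greatest one ([P_forcing] below has none). *)
Inductive is_check (P : forcing) (x t : V) : Prop :=
| IsCheck :
    (forall y p, y ∈ x -> cond P p ->
       exists s, is_check P y s /\ pair s p ∈ t) ->
    (forall z, z ∈ t ->
       exists y s p, y ∈ x /\ is_check P y s /\ cond P p /\ z = pair s p) ->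
    is_check P x t.

Definition countable_ordinal_name (P : forcing) (a : V) : Prop :=
  name P a /\
  exists w, is_check P omega1 w /\ forall p, cond P p -> forces_in P p a w.

(** * Elementary submodels of [H_lambda] and semiproperness *)

Definition tc (x : V) : V -> Prop := fun z => clos_trans V mem z x.

Definition Hset (lambda : V) : V -> Prop :=
  fun x => exists mu, cardinality (tc x) mu /\ mu ∈ lambda.

Definition well_orders (A : V -> Prop) (R : V -> V -> Prop) : Prop :=
  (forall x, A x -> ~ R x x) /\
  (forall x y z, A x -> A y -> A z -> R x y -> R y z -> R x z) /\
  (forall x y, A x -> A y -> R x y \/ x = y \/ R y x) /\
  (forall B : V -> Prop, (forall x, B x -> A x) -> (exists x, B x) ->
     exists m, B m /\ forall x, B x -> ~ R x m).

(** First-order formulas in the language of [(H_lambda, ∈, <, P, ||-)], with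
    variables named by natural numbers.  The poset contributes a predicate for
    its conditions and one for its order, the forcing relation its two atomic
    instances. *)
Inductive formula : Type :=
| FIn (i j : nat)
| FEq (i j : nat)
| FLt (i j : nat)
| FCond (i : nat)
| FExt (i j : nat)
| FForcesEq (i j k : nat)
| FForcesIn (i j k : nat)
| FNot (phi : formula)
| FAnd (phi psi : formula)
| FEx (i : nat) (phi : formula).

Definition upd (e : nat -> V) (i : nat) (a : V) : nat -> V :=
  fun j => if Nat.eqb j i then a else e j.

Fixpoint sat (P : forcing) (lt : V -> V -> Prop) (M : V -> Prop)
    (phi : formula) (e : nat -> V) : Prop :=
  match phi with
  | FIn i j => e i ∈ e j
  | FEq i j => e i = e j
  | FLt i j => lt (e i) (e j)
  | FCond i => cond P (e i)
  | FExt i j => cond P (e i) /\ cond P (e j) /\ ext P (e i) (e j)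
  | FForcesEq i j k => cond P (e i) /\ name P (e j) /\ name P (e k) /\
                       forces_eq P (e i) (e j) (e k)
  | FForcesIn i j k => cond P (e i) /\ name P (e j) /\ name P (e k) /\
                       forces_in P (e i) (e j) (e k)
  | FNot phi => ~ sat P lt M phi e
  | FAnd phi psi => sat P lt M phi e /\ sat P lt M psi e
  | FEx i phi => exists a, M a /\ sat P lt M phi (upd e i a)
  end.

Definition elementary (P : forcing) (lt : V -> V -> Prop) (N : V -> Prop)
    (M : V) : Prop :=
  (exists x, x ∈ M) /\ (forall x, x ∈ M -> N x) /\
  forall phi e, (forall n, e n ∈ M) ->
    (sat P lt (elts M) phi e <-> sat P lt N phi e).

Definition semigeneric (P : forcing) (M q : V) : Prop :=
  forall a, a ∈ M -> countable_ordinal_name P a ->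
  exists b t, b ∈ M /\ is_check P b t /\ forces_eq P q a t.

Definition semiproper (P : forcing) : Prop :=
  exists mu, cardinality (cond P) mu /\ omega1 ⊆ mu /\
  forall nu lambda, card_succ mu nu -> cardinal lambda -> nu ⊆ lambda ->
  forall lt, well_orders (Hset lambda) lt ->
  exists C, club (Hset lambda) C /\
    forall M, C M ->
      elementary P lt (Hset lambda) M /\
      forall p, cond P p -> p ∈ M ->
        exists q, cond P q /\ ext P q p /\ semigeneric P M q.

(** * The forcing [P_S] *)

(** [p] is the sequence [⟨x α : α <= gamma⟩], as a set of ordered pairs. *)
Definition is_seq (gamma : V) (x : V -> V) (p : V) : Prop :=
  forall z, z ∈ p <->
    exists alpha, (alpha ∈ gamma \/ alpha = gamma) /\ z = pair alpha (x alpha).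

Definition limit (alpha : V) : Prop :=
  ordinal alpha /\ (exists b, b ∈ alpha) /\
  forall b, b ∈ alpha -> exists c, c ∈ alpha /\ b ∈ c.

Definition P_cond (S : V -> Prop) (p : V) : Prop :=
  exists gamma x, gamma ∈ omega1 /\ is_seq gamma x p /\
    (forall a, a ∈ gamma \/ a = gamma -> S (x a)) /\
    (forall a b, b ∈ gamma \/ b = gamma -> a ∈ b ->
       x a ⊆ x b /\ delta (x a) ∈ delta (x b)) /\
    (forall a, a ∈ gamma \/ a = gamma -> limit a ->
       forall z, z ∈ x a <-> exists b, b ∈ a /\ z ∈ x b).

Definition end_extends (q p : V) : Prop :=
  exists gamma gamma' x, gamma ∈ omega1 /\ gamma' ∈ omega1 /\ gamma ⊆ gamma' /\
    is_seq gamma x p /\ is_seq gamma' x q.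

Definition P_forcing (S : V -> Prop) : forcing := Forcing (P_cond S) end_extends.

(* Main.v *)
(** Clubs are handled through closure: every club in [[A]^ω] contains the set
    of all [x] closed under a function assigning countable subsets of [A] to
    finite sequences from [A] (Kueker), and traces of clubs on subsets of [A]
    contain clubs for the same reason.

    Spanning implies semiproper.  Given [M] in a suitable club, spanning
    provides [N ⊇ M] closed under enough functions with [δ_N = δ_M] and
    [N ∩ κ ∈ S].  A descending sequence of conditions in [N] that decides all
    names in [N] for countable ordinals has last members with union [N ∩ κ];
    adding [N ∩ κ] on top yields a condition [q].  It decides these names to be
    elements of [N ∩ ω1 = M ∩ ω1], so it is semigeneric for [M].

    Semiproper implies spanning.  Since [S] is stationary, [P_S] adds no new
    countable sequences.  Given [M] elementary enough, extend a semigeneric [q]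
    to [r] of length greater than [δ_M] that decides all names in [M] for
    elements of [λ], and let [y] be the set of the decided values.  By
    semigenericity [δ_y = δ_M], and [y ∩ κ] is the [δ_M]-th entry of [r], which
    belongs to [S]. *)

From Stdlib Require Import Classical ClassicalEpsilon FunctionalExtensionality
  Relations Wellfounded List Arith Lia Cantor.
Require Import Defs.
Import ListNotations.

(** Everything takes place in the ground model: neither generic filters nor evaluations of names
    occur. A name for an element of λ is replaced by a partial function on conditions with open
    dense domain; genuine names are built only for countable ordinals, where semigenericity has to
    be applied. One condition [r] lying in all relevant domains takes over the role of the generic
    filter.

    Why y ∩ κ is the δ_M-th entry of [r]: the first index at which a decided value from κ enters the
    generic sequence is a countable ordinal with a name in M, so semigenericity puts it below δ_M.
    Conversely, every element of an entry with index below δ_M is the value of a name in M, and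
    continuity at the limit δ_M gives the entry itself.

    One mismatch has to be bridged: spanning speaks of cardinals λ, whereas the submodels live in
    H_λ, to which P_S and κ are adjoined. Moving along a bijection to a cardinal must change neither
    δ nor the trace on κ. *)

(** * Elementary set theory: choice, pairs, small classes *)

Lemma V_inhabited : inhabited V.
Proof. exact (inhabits (cls (Sup False (fun e => match e with end)))). Qed.

Definition eps (Q : V -> Prop) : V := epsilon V_inhabited Q.

Lemma eps_spec (Q : V -> Prop) : (exists x, Q x) -> Q (eps Q).
Proof. apply epsilon_spec. Qed.

Definition emp : V := range (fun e : False => match e with end).

Lemma mem_emp z : ~ z ∈ emp.
Proof. unfold emp; rewrite mem_range; intros [[] _]. Qed.

Lemma incl_refl x : x ⊆ x.
Proof. intros z H; exact H. Qed.

Lemma incl_trans x y z : x ⊆ y -> y ⊆ z -> x ⊆ z.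
Proof. intros H K w Hw; auto. Qed.

Lemma incl_antisym x y : x ⊆ y -> y ⊆ x -> x = y.
Proof. intros H K; apply set_ext; split; auto. Qed.

Lemma mem_upair x y z : z ∈ upair x y <-> z = x \/ z = y.
Proof.
  unfold upair; rewrite mem_range; split.
  - intros [[] ->]; auto.
  - intros [->| ->]; [exists true|exists false]; auto.
Qed.

Lemma upair_inj a b c d : upair a b = upair c d ->
  (a = c /\ b = d) \/ (a = d /\ b = c).
Proof.
  intros E.
  assert (K : forall z, (z = a \/ z = b) <-> (z = c \/ z = d)).
  { intros z; rewrite <- !mem_upair, E; reflexivity. }
  destruct (proj1 (K a) (or_introl eq_refl)), (proj1 (K b) (or_intror eq_refl)),
    (proj2 (K c) (or_introl eq_refl)), (proj2 (K d) (or_intror eq_refl));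
    subst; auto.
Qed.

Lemma pair_inj a b c d : pair a b = pair c d -> a = c /\ b = d.
Proof.
  unfold pair; intros E.
  destruct (upair_inj _ _ _ _ E) as [[H1 H2]|[H1 H2]];
    destruct (upair_inj _ _ _ _ H1) as [[? ?]|[? ?]];
    destruct (upair_inj _ _ _ _ H2) as [[? ?]|[? ?]]; subst; auto.
Qed.

Lemma small_image2 (f : V -> V -> V) (p q : V -> Prop) : small p -> small q ->
  small (fun z => exists x y, p x /\ q y /\ z = f x y).
Proof.
  intros (A & g & H) (B & h & K); exists (A * B)%type.
  exists (fun c => f (g (fst c)) (h (snd c))).
  intros z (x & y & Hx & Hy & ->).
  destruct (H x Hx) as [a ->], (K y Hy) as [b ->].
  exists (a, b); reflexivity.
Qed.

Lemma small_image (f : V -> V) (p : V -> Prop) : small p ->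
  small (fun z => exists x, p x /\ z = f x).
Proof.
  intros (A & g & H); exists A, (fun a => f (g a)).
  intros z (x & Hx & ->); destruct (H x Hx) as [a ->]; exists a; reflexivity.
Qed.

Lemma small_or (p q : V -> Prop) : small p -> small q ->
  small (fun z => p z \/ q z).
Proof.
  intros (A & g & H) (B & h & K); exists (A + B)%type.
  exists (fun c => match c with inl a => g a | inr b => h b end).
  intros z [Hz|Hz]; [destruct (H z Hz) as [a ->]; exists (inl a)|
    destruct (K z Hz) as [a ->]; exists (inr a)]; reflexivity.
Qed.

Lemma small_pow (p : V -> Prop) : small p ->
  small (fun x => forall z, z ∈ x -> p z).
Proof.
  intros (A & g & H); exists (A -> Prop).
  exists (fun Q => range (fun a : {a | Q a} => g (proj1_sig a))).
  intros x Hx; exists (fun a => g a ∈ x).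
  apply set_ext; intros z; rewrite mem_range; split.
  - intros Hz; destruct (H z (Hx z Hz)) as [a ->]; exists (exist _ a Hz); auto.
  - intros [[a Ha] ->]; exact Ha.
Qed.

Lemma small_iunion {I : Type} (Q : I -> V -> Prop) :
  (forall i, small (Q i)) -> small (fun z => exists i, Q i z).
Proof.
  intros H.
  pose (w := fun i => constructive_indefinite_description _ (H i)).
  exists {i : I & proj1_sig (w i)}.
  exists (fun c => proj1_sig (constructive_indefinite_description _
    (proj2_sig (w (projT1 c)))) (projT2 c)).
  intros z [i Hz].
  destruct (proj2_sig (constructive_indefinite_description _
    (proj2_sig (w i))) z Hz) as [a Ha].
  exists (existT _ i a); exact Ha.
Qed.

Lemma small_bigunion (p : V -> Prop) (Q : V -> V -> Prop) : small p ->
  (forall x, small (Q x)) -> small (fun z => exists x, p x /\ Q x z).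
Proof.
  intros (A & g & H) K.
  apply small_sub with (fun z => exists a, Q (g a) z);
    [|apply small_iunion; intros a; apply K].
  intros z (x & Hx & Hz); destruct (H x Hx) as [a ->]; eauto.
Qed.

Lemma small_eq a : small (fun z => z = a).
Proof. exists unit, (fun _ => a); intros z ->; exists tt; reflexivity. Qed.

(** * Ordinals *)

Lemma mem_min (Q : V -> Prop) : (exists x, Q x) ->
  exists x, Q x /\ forall y, y ∈ x -> ~ Q y.
Proof.
  intros [x Hx]; revert Hx; induction (mem_wf x) as [x _ IH]; intros Hx.
  destruct (classic (exists y, y ∈ x /\ Q y)) as [(y & H & K)|N]; [eauto|].
  exists x; split; [exact Hx|]; intros y H K; apply N; eauto.
Qed.

Lemma mem_irrefl x : ~ x ∈ x.
Proof. induction (mem_wf x) as [x _ IH]; intros H; exact (IH x H H). Qed.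

Lemma mem_asym x y : x ∈ y -> ~ y ∈ x.
Proof.
  revert y; induction (mem_wf x) as [x _ IH]; intros y H K; exact (IH y K x K H).
Qed.

Lemma ord_trich x y : ordinal x -> ordinal y -> x ∈ y \/ x = y \/ y ∈ x.
Proof.
  revert y; induction (mem_wf x) as [x _ IHx]; intros y Ox.
  induction (mem_wf y) as [y _ IHy]; intros Oy.
  destruct (classic (y ∈ x)) as [H|H]; [auto|].
  destruct (classic (x ∈ y)) as [H'|H']; [auto|].
  right; left; apply set_ext; intros z; split; intros Hz.
  - destruct (IHx z Hz y (ordinal_mem x z Ox Hz) Oy) as [K|[->|K]]; auto.
    + contradiction.
    + destruct H; apply (proj1 Ox z Hz y K).
  - destruct (IHy z Hz (ordinal_mem y z Oy Hz)) as [K|[->|K]]; auto.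
    + destruct H'; apply (proj1 Oy z Hz x K).
    + contradiction.
Qed.

Lemma ord_mem_or_incl x y : ordinal x -> ordinal y -> x ∈ y \/ y ⊆ x.
Proof.
  intros Ox Oy; destruct (ord_trich x y Ox Oy) as [H|[->|H]]; auto.
  - right; apply incl_refl.
  - right; apply (proj1 Ox y H).
Qed.

Lemma ord_incl_eq x y : ordinal x -> ordinal y -> x ⊆ y -> x ∈ y \/ x = y.
Proof.
  intros Ox Oy H; destruct (ord_trich x y Ox Oy) as [K|[->|K]]; auto.
  destruct (mem_irrefl y); apply H, K.
Qed.

Lemma ord_intro x : transitive x -> (forall y, y ∈ x -> ordinal y) -> ordinal x.
Proof. intros T H; split; [exact T|]; intros y Hy; exact (proj1 (H y Hy)). Qed.

(** * Countability *)

(** Polymorphic in [T], since lists and formulas have to be counted too. The range of [e] may exceed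
    [B], so the empty class needs no separate case when [T] is inhabited. *)
Definition enumerable {T : Type} (B : T -> Prop) : Prop :=
  exists e : nat -> T, forall x, B x -> exists n, x = e n.

Lemma countable_enumerable (B : V -> Prop) : countable B <-> enumerable B.
Proof.
  split.
  - intros [f If]; exists (fun n => eps (fun x => B x /\ f x = n)).
    intros x Hx; exists (f x).
    destruct (eps_spec (fun y => B y /\ f y = f x)) as [H K]; eauto.
  - intros [e He].
    exists (fun x => epsilon (inhabits 0) (fun n => x = e n)).
    intros x y Hx Hy E.
    pose proof (epsilon_spec (inhabits 0) (fun n => x = e n) (He x Hx)) as K1.
    pose proof (epsilon_spec (inhabits 0) (fun n => y = e n) (He y Hy)) as K2.
    cbv beta in *; rewrite K1, K2, E; reflexivity.
Qed.

Lemma enum_sub {T} (B B' : T -> Prop) : (forall x, B x -> B' x) ->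
  enumerable B' -> enumerable B.
Proof. intros H [e He]; exists e; auto. Qed.

Lemma enum_image {T U} (f : T -> U) (B : T -> Prop) (B' : U -> Prop) :
  enumerable B -> (forall y, B' y -> exists x, B x /\ y = f x) -> enumerable B'.
Proof.
  intros [e He] H; exists (fun n => f (e n)).
  intros y Hy; destruct (H y Hy) as (x & Hx & ->).
  destruct (He x Hx) as [n ->]; eauto.
Qed.

Lemma enum_nat : enumerable (fun _ : nat => True).
Proof. exists (fun n => n); eauto. Qed.

Lemma enum_prod {T U} (B : T -> Prop) (B' : U -> Prop) :
  enumerable B -> enumerable B' ->
  enumerable (fun c : T * U => B (fst c) /\ B' (snd c)).
Proof.
  intros [e He] [e' He'].
  exists (fun n => (e (fst (of_nat n)), e' (snd (of_nat n)))).
  intros [x y] [Hx Hy]; simpl in *.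
  destruct (He x Hx) as [n ->], (He' y Hy) as [m ->].
  exists (to_nat (n, m)); rewrite cancel_of_to; reflexivity.
Qed.

Lemma enum_bigunion {T U} (t : inhabited U) (I : T -> Prop) (Q : T -> U -> Prop) :
  enumerable I -> (forall i, I i -> enumerable (Q i)) ->
  enumerable (fun x => exists i, I i /\ Q i x).
Proof.
  intros [e He] H; destruct t as [t].
  pose (g := fun i => epsilon (inhabits (fun _ : nat => t))
    (fun d => forall x, Q i x -> exists n, x = d n)).
  exists (fun n => g (e (fst (of_nat n))) (snd (of_nat n))).
  intros x (i & Hi & Hx); destruct (He i Hi) as [n Hn].
  assert (K : forall x, Q i x -> exists n, x = g i n).
  { apply (epsilon_spec (inhabits (fun _ : nat => t))); apply H, Hi. }
  destruct (K x Hx) as [m ->].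
  exists (to_nat (n, m)); rewrite cancel_of_to; simpl; rewrite Hn; reflexivity.
Qed.

Lemma enum_or {T} (B B' : T -> Prop) : enumerable B -> enumerable B' ->
  enumerable (fun x => B x \/ B' x).
Proof.
  intros [e He] [e' He'].
  exists (fun n => match of_nat n with (0, m) => e m | (_, m) => e' m end).
  intros x [Hx|Hx]; [destruct (He x Hx) as [n ->]|destruct (He' x Hx) as [n ->]];
    [exists (to_nat (0, n))|exists (to_nat (1, n))];
    rewrite cancel_of_to; reflexivity.
Qed.

Lemma enum_eq {T} (a : T) : enumerable (fun x => x = a).
Proof. exists (fun _ => a); intros x ->; exists 0; reflexivity. Qed.

Lemma enum_list {T} (B : T -> Prop) : enumerable B -> enumerable (Forall B).
Proof.
  intros HB.
  apply enum_sub with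
    (fun l => exists k, True /\ (length l = k /\ Forall B l)).
  { intros l Hl; exists (length l); auto. }
  apply enum_bigunion; [exact (inhabits nil)|exact enum_nat|].
  intros k _; induction k as [|k IH].
  - apply enum_sub with (fun l => l = nil); [|apply enum_eq].
    intros [|a l] [H _]; [reflexivity|discriminate].
  - apply (enum_image (fun c => fst c :: snd c)
      (fun c : T * list T => B (fst c) /\
        (length (snd c) = k /\ Forall B (snd c)))).
    + apply (enum_prod B (fun l => length l = k /\ Forall B l)); assumption.
    + intros [|a l] [H K]; [discriminate|]; inversion K; subst.
      exists (a, l); simpl; auto.
Qed.

(** [en x] enumerates a superset of [x] when [x] is countable. *)
Definition en (x : V) : nat -> V :=
  epsilon (inhabits (fun _ => emp)) (fun d => forall z, z ∈ x -> exists n, z = d n).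

Lemma en_spec x z : countable (elts x) -> z ∈ x -> exists n, z = en x n.
Proof.
  intros H; apply countable_enumerable in H; revert z.
  exact (epsilon_spec (inhabits (fun _ => emp))
    (fun d => forall z, z ∈ x -> exists n, z = d n) H).
Qed.

Lemma countable_sub (B B' : V -> Prop) : (forall x, B x -> B' x) ->
  countable B' -> countable B.
Proof. rewrite !countable_enumerable; apply enum_sub. Qed.

Lemma small_countable (B : V -> Prop) : countable B -> small B.
Proof.
  rewrite countable_enumerable; intros [e He]; exists nat, e; exact He.
Qed.

Lemma omega1_trans : transitive omega1.
Proof.
  intros y Hy z Hz; apply mem_omega1 in Hy; destruct Hy as [Oy Cy].
  apply mem_omega1; split; [apply (ordinal_mem y z Oy Hz)|].
  apply countable_sub with (elts y); [|exact Cy].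
  intros w Hw; apply (proj1 Oy z Hz w Hw).
Qed.

Lemma omega1_ord a : a ∈ omega1 -> ordinal a.
Proof. intros H; apply mem_omega1 in H; exact (proj1 H). Qed.

Lemma omega1_countable a : a ∈ omega1 -> countable (elts a).
Proof. intros H; apply mem_omega1 in H; exact (proj2 H). Qed.

Lemma ordinal_omega1 : ordinal omega1.
Proof. apply ord_intro; [apply omega1_trans|apply omega1_ord]. Qed.

Lemma omega1_uncountable : ~ countable (elts omega1).
Proof.
  intros H; apply (mem_irrefl omega1), mem_omega1; split;
    [apply ordinal_omega1|exact H].
Qed.

Lemma omega1_intro x : transitive x -> countable (elts x) -> x ⊆ omega1 ->
  x ∈ omega1.
Proof.
  intros T C H; apply mem_omega1; split; [|exact C].
  apply ord_intro; [exact T|]; intros y Hy; apply omega1_ord, H, Hy.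
Qed.

Lemma emp_omega1 : emp ∈ omega1.
Proof.
  apply omega1_intro.
  - intros y Hy; destruct (mem_emp y Hy).
  - exists (fun _ => 0); intros y z Hy; destruct (mem_emp y Hy).
  - intros y Hy; destruct (mem_emp y Hy).
Qed.

Definition succ (a : V) : V := setof (fun z => z ∈ a \/ z = a).

Lemma mem_succ a z : z ∈ succ a <-> z ∈ a \/ z = a.
Proof.
  revert z; apply mem_setof, small_or; [apply small_elts|apply small_eq].
Qed.

Lemma succ_omega1 a : a ∈ omega1 -> succ a ∈ omega1.
Proof.
  intros Ha; apply omega1_intro.
  - intros y Hy z Hz; apply mem_succ in Hy; apply mem_succ; left.
    destruct Hy as [Hy| ->]; [|exact Hz].
    apply (proj1 (omega1_ord a Ha) y Hy z Hz).
  - apply countable_enumerable.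
    apply enum_sub with (fun z => z ∈ a \/ z = a); [intros z; apply mem_succ|].
    apply enum_or; [|apply enum_eq].
    apply countable_enumerable, omega1_countable, Ha.
  - intros y Hy; apply mem_succ in Hy; destruct Hy as [Hy| ->]; [|exact Ha].
    apply (omega1_trans a Ha y Hy).
Qed.

Definition union (f : nat -> V) : V := setof (fun z => exists n, z ∈ f n).

Lemma mem_union f z : z ∈ union f <-> exists n, z ∈ f n.
Proof.
  revert z; apply mem_setof.
  apply small_iunion; intros n; apply (small_elts (f n)).
Qed.

(** * Cardinals *)

Definition injects (A B : V -> Prop) : Prop :=
  exists f : V -> V, (forall x, A x -> B (f x)) /\ inj_on A f.

Lemma injects_trans A B C : injects A B -> injects B C -> injects A C.
Proof.
  intros (f & Hf & If) (g & Hg & Ig); exists (fun x => g (f x)); split; auto.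
  intros x y Hx Hy E; auto.
Qed.

Lemma injects_sub (A B : V -> Prop) : (forall x, A x -> B x) -> injects A B.
Proof. intros H; exists (fun x => x); split; [exact H|]; intros x y _ _ E; exact E. Qed.

Lemma equinum_injects A B : equinum A B -> injects A B.
Proof. intros (f & H & I & _); exists f; auto. Qed.

Lemma equinum_sym A B : equinum A B -> equinum B A.
Proof.
  intros (f & H & I & J).
  pose (g := fun y => eps (fun x => A x /\ f x = y)).
  assert (K : forall y, B y -> A (g y) /\ f (g y) = y).
  { intros y Hy; exact (eps_spec (fun x => A x /\ f x = y) (J y Hy)). }
  exists g; split; [|split].
  - intros y Hy; apply K, Hy.
  - intros x y Hx Hy E.
    rewrite <- (proj2 (K x Hx)), <- (proj2 (K y Hy)), E; reflexivity.
  - intros x Hx; exists (f x); split; [auto|].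
    apply I; [apply K; auto|exact Hx|apply K; auto].
Qed.

Lemma equinum_trans A B C : equinum A B -> equinum B C -> equinum A C.
Proof.
  intros (f & Hf & If & Jf) (g & Hg & Ig & Jg); exists (fun x => g (f x)).
  split; [auto|]; split.
  - intros x y Hx Hy E; auto.
  - intros z Hz; destruct (Jg z Hz) as (y & Hy & <-).
    destruct (Jf y Hy) as (x & Hx & <-); eauto.
Qed.

Lemma injects_countable A B : injects A B -> countable B -> countable A.
Proof.
  intros (f & Hf & If) (g & Ig); exists (fun x => g (f x)).
  intros x y Hx Hy E; auto.
Qed.

Lemma schroeder_bernstein A B : injects A B -> injects B A -> equinum A B.
Proof.
  intros (f & Hf & If) (g & Hg & Ig).
  (* [D] consists of the points reached from [A] minus the range of [g] by iterating [g] after [f].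
     The bijection is [f] on [D] and the inverse of [g] elsewhere. *)
  pose (C := fix C n x := match n with
    | 0 => A x /\ ~ exists y, B y /\ g y = x
    | S n => exists y, A y /\ C n y /\ x = g (f y) end).
  pose (D := fun x => exists n, C n x).
  pose (g' := fun x => eps (fun y => B y /\ g y = x)).
  assert (G : forall x, A x -> ~ D x -> B (g' x) /\ g (g' x) = x).
  { intros x Hx N; apply (eps_spec (fun y => B y /\ g y = x)), NNPP.
    intros K; apply N; exists 0; split; assumption. }
  exists (fun x => if excluded_middle_informative (D x) then f x else g' x).
  split; [|split].
  - intros x Hx; destruct (excluded_middle_informative (D x)); [auto|].
    apply G; assumption.
  - assert (X : forall x y, A x -> A y -> D x -> ~ D y -> f x <> g' y).
    { intros x y Hx Hy [n Dx] N E; apply N; exists (S n); exists x.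
      split; [|split]; [exact Hx|exact Dx|].
      rewrite E; symmetry; apply G; assumption. }
    intros x y Hx Hy E.
    destruct (excluded_middle_informative (D x)) as [Dx|Dx],
      (excluded_middle_informative (D y)) as [Dy|Dy].
    + auto.
    + destruct (X x y Hx Hy Dx Dy E).
    + destruct (X y x Hy Hx Dy Dx (eq_sym E)).
    + rewrite <- (proj2 (G x Hx Dx)), <- (proj2 (G y Hy Dy)), E; reflexivity.
  - intros y Hy; destruct (classic (D (g y))) as [[n Dn]|N].
    + destruct n as [|n]; [destruct Dn as [_ []]; eauto|].
      destruct Dn as (x & Hx & Cx & E); exists x; split; [exact Hx|].
      destruct (excluded_middle_informative (D x)) as [_|[]]; [|exists n; exact Cx].
      apply Ig; auto.
    + exists (g y); split; [auto|].
      destruct (excluded_middle_informative (D (g y))); [contradiction|].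
      apply Ig; [apply G; auto|exact Hy|apply G; auto].
Qed.

(** [pick A] chooses elements of [A] one after the other, without repetition
    as long as possible. *)
Definition pick (A : V -> Prop) : V -> V :=
  Fix mem_wf (fun _ => V)
    (fun a rec => eps (fun x => A x /\ forall b (h : b ∈ a), rec b h <> x)).

Lemma pick_eq A a :
  pick A a = eps (fun x => A x /\ forall b, b ∈ a -> pick A b <> x).
Proof.
  unfold pick at 1; rewrite Fix_eq; [reflexivity|].
  intros x f g H; replace g with f; [reflexivity|].
  apply functional_extensionality_dep; intros y.
  apply functional_extensionality_dep; intros h; apply H.
Qed.

(** Burali-Forti: a set of all ordinals would be an ordinal and hence a member of itself. *)
Lemma not_small_ordinal : ~ small ordinal.
Proof.
  intros H; pose proof (mem_setof ordinal H) as K.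
  apply (mem_irrefl (setof ordinal)), K, ord_intro.
  - intros y Hy z Hz; apply K; apply K in Hy; exact (ordinal_mem y z Hy Hz).
  - intros y; apply K.
Qed.

(** If [pick A] never ran out of fresh elements, it would inject the ordinals into [A], and
    replacement would make them a set. At the least ordinal where it runs out, it is a bijection
    onto [A]. *)
Lemma small_equinum_ordinal A : small A -> exists a, ordinal a /\ equinum (elts a) A.
Proof.
  intros HA.
  pose (Q := fun a => exists x, A x /\ forall b, b ∈ a -> pick A b <> x).
  assert (HQ : forall a, Q a ->
    A (pick A a) /\ forall b, b ∈ a -> pick A b <> pick A a).
  { intros a Ha; rewrite (pick_eq A a).
    exact (eps_spec (fun x => A x /\ forall b, b ∈ a -> pick A b <> x) Ha). }
  assert (E : exists a, ordinal a /\ ~ Q a).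
  { apply NNPP; intros N; apply not_small_ordinal.
    assert (K : forall a, ordinal a -> Q a).
    { intros a Ha; apply NNPP; intros M; apply N; eauto. }
    apply small_sub with (fun z => exists x, A x /\
      z = eps (fun a => ordinal a /\ pick A a = x)); [|apply small_image, HA].
    intros a Ha; exists (pick A a); split; [apply HQ, K, Ha|].
    destruct (eps_spec (fun b => ordinal b /\ pick A b = pick A a)) as [H1 H2].
    { eauto. }
    set (b := eps _) in *; clearbody b.
    destruct (ord_trich a b Ha H1) as [H|[H|H]]; [|exact H|].
    - destruct (proj2 (HQ b (K b H1)) a H); auto.
    - destruct (proj2 (HQ a (K a Ha)) b H); auto. }
  destruct (mem_min _ E) as (a & [Oa Na] & M).
  assert (K : forall b, b ∈ a -> Q b).
  { intros b Hb; apply NNPP; intros N; apply (M b Hb); split; [|exact N].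
    apply (ordinal_mem a b Oa Hb). }
  exists a; split; [exact Oa|]; exists (pick A); split; [|split].
  - intros x Hx; apply HQ, K, Hx.
  - intros x y Hx Hy Exy.
    destruct (ord_trich x y (ordinal_mem a x Oa Hx) (ordinal_mem a y Oa Hy))
      as [H|[H|H]]; [|exact H|].
    + destruct (proj2 (HQ y (K y Hy)) x H Exy).
    + destruct (proj2 (HQ x (K x Hx)) y H (eq_sym Exy)).
  - intros y Hy; apply NNPP; intros N; apply Na; exists y; split; [exact Hy|].
    intros b Hb Eb; apply N; exists b; auto.
Qed.

Lemma cardinality_exists A : small A -> exists mu, cardinality A mu.
Proof.
  intros HA; destruct (mem_min _ (small_equinum_ordinal A HA)) as (a & [Oa Ea] & M).
  exists a; split; [split; [exact Oa|]|apply equinum_sym, Ea].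
  intros b Hb Eb; apply (M b Hb); split; [apply (ordinal_mem a b Oa Hb)|].
  apply equinum_trans with (elts a); assumption.
Qed.

Lemma cardinal_not_injects k r : cardinal k -> r ∈ k ->
  ~ injects (elts k) (elts r).
Proof.
  intros [Ok H] Hr I; apply (H r Hr), schroeder_bernstein; [|exact I].
  apply injects_sub; exact (proj1 Ok r Hr).
Qed.

Lemma cardinal_incl k r : cardinal k -> cardinal r ->
  injects (elts r) (elts k) -> r ⊆ k.
Proof.
  intros Ck Cr I.
  destruct (ord_mem_or_incl k r (proj1 Ck) (proj1 Cr)) as [H|H]; auto.
  destruct (cardinal_not_injects r k Cr H I).
Qed.

(** Cantor's diagonal argument, in the form for injections of the power set. *)
Lemma pow_not_injects r : ~ injects (fun x => x ⊆ r) (elts r).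
Proof.
  intros (f & Hf & If).
  pose (D := setof (fun z => z ∈ r /\ forall x, x ⊆ r -> f x = z -> ~ z ∈ x)).
  assert (HD : forall z, z ∈ D <->
    z ∈ r /\ forall x, x ⊆ r -> f x = z -> ~ z ∈ x).
  { apply mem_setof; apply small_sub with (elts r); [|apply small_elts].
    intros z [H _]; exact H. }
  assert (DS : D ⊆ r) by (intros z Hz; apply HD, Hz).
  assert (N : ~ f D ∈ D).
  { intros H; exact (proj2 (proj1 (HD _) H) D DS eq_refl H). }
  apply N, HD; split; [exact (Hf D DS)|]; intros x Hx E.
  rewrite (If x D Hx DS E); exact N.
Qed.

Lemma cardinal_above r : ordinal r -> exists k, cardinal k /\ r ∈ k.
Proof.
  intros Or; destruct (cardinality_exists (fun x => x ⊆ r)) as (k & Ck & E).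
  { apply (small_pow (elts r)), small_elts. }
  exists k; split; [exact Ck|].
  destruct (ord_mem_or_incl r k Or (proj1 Ck)) as [H|H]; [exact H|].
  destruct (pow_not_injects r); apply injects_trans with (elts k).
  - apply equinum_injects, E.
  - apply injects_sub; exact H.
Qed.

Lemma card_succ_exists r : ordinal r -> exists k, card_succ r k.
Proof.
  intros Or; destruct (mem_min _ (cardinal_above r Or)) as (k & [Ck H] & M).
  exists k; split; [exact Ck|]; split; [exact H|].
  intros s Cs Hs; destruct (ord_mem_or_incl s k (proj1 Cs) (proj1 Ck)) as [K|K];
    [|exact K].
  destruct (M s K); auto.
Qed.

(** * The sets [H_lambda] *)

Lemma small_tc x : small (tc x).
Proof.
  (* [L x n] is the n-fold union of [x]; the transitive closure is covered by these countably many
     levels. *)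
  pose (L := fun x => fix L n z := match n with
    | 0 => z ∈ x | S n => exists y, L n y /\ z ∈ y end).
  apply small_sub with (fun z => exists n, L x n z).
  - intros z Hz; apply clos_trans_t1n in Hz.
    induction Hz as [z x Hz|z y x H _ [n IH]]; [exists 0; exact Hz|].
    exists (S n); exists y; auto.
  - apply small_iunion; intros n; induction n as [|n IH]; [apply small_elts|].
    apply (small_bigunion (L x n) (fun y z => z ∈ y)); [exact IH|apply small_elts].
Qed.

Lemma tc_elts x z : z ∈ x -> tc x z.
Proof. intros H; apply t_step, H. Qed.

Lemma tc_mem x y z : tc x y -> z ∈ y -> tc x z.
Proof. intros H K; apply t_trans with y; [apply t_step, K|exact H]. Qed.

Lemma tc_transitive x z : transitive x -> tc x z -> z ∈ x.
Proof.
  intros T H; apply clos_trans_t1n in H; revert T.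
  induction H as [z x H|z y x H _ IH]; intros T; [exact H|].
  exact (T y (IH T) z H).
Qed.

Lemma Hset_intro k r z : cardinal k -> r ∈ k -> injects (tc z) (elts r) ->
  Hset k z.
Proof.
  intros Ck Hr I; destruct (cardinality_exists (tc z) (small_tc z)) as (s & Cs & E).
  exists s; split; [split; assumption|].
  destruct (ord_mem_or_incl s k (proj1 Cs) (proj1 Ck)) as [H|H]; [exact H|].
  destruct (cardinal_not_injects k r Ck Hr).
  apply injects_trans with (elts s); [apply injects_sub; exact H|].
  apply injects_trans with (tc z); [|exact I].
  apply equinum_injects, equinum_sym, E.
Qed.

(** Semiproperness may be applied to any large cardinal; this provides one whose H contains all
    names that will be needed. It is a cardinal above the size of [n] together with all transitive
    closures of members of [W]. *)
Lemma Hset_above (W : V -> Prop) (n : V) : small W -> ordinal n ->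
  exists k, cardinal k /\ n ⊆ k /\ forall z, W z -> Hset k z.
Proof.
  intros HW On.
  pose (X := fun z => z ∈ n \/ exists w, W w /\ tc w z).
  destruct (cardinality_exists X) as (r & Cr & E).
  { apply small_or; [apply small_elts|].
    apply (small_bigunion W tc); [exact HW|apply small_tc]. }
  destruct (cardinal_above r (proj1 Cr)) as (k & Ck & Hr).
  exists k; split; [exact Ck|]; split.
  - destruct (ord_mem_or_incl k n (proj1 Ck) On) as [H|H]; [|exact H].
    destruct (cardinal_not_injects k r Ck Hr).
    apply injects_trans with X; [|apply equinum_injects, E].
    apply injects_sub; intros z Hz; left; exact (proj1 On k H z Hz).
  - intros z Hz; apply (Hset_intro k r z Ck Hr).
    apply injects_trans with X; [|apply equinum_injects, E].
    apply injects_sub; intros y Hy; right; eauto.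
Qed.

(* A set is determined by the isomorphism type of [∈] on its transitive
   closure together with the position of its elements there. *)
Lemma small_Hset k : cardinal k -> small (Hset k).
Proof.
  intros Ck; destruct (small_elts k) as (T & f & Hf).
  pose (codes (R : T -> T -> Prop) (D B : T -> Prop) (x : V) :=
    exists i : V -> T, inj_on (tc x) i /\
      (forall t, D t <-> exists y, tc x y /\ i y = t) /\
      (forall t, B t <-> exists y, y ∈ x /\ i y = t) /\
      (forall y z, tc x y -> tc x z -> (R (i y) (i z) <-> y ∈ z))).
  assert (uniq : forall R D B x x', codes R D B x -> codes R D B x' -> x = x').
  { intros R D B x x' (i & Ii & Di & Bi & Ri) (j & Ij & Dj & Bj & Rj).
    assert (K : forall y, tc x y -> forall y', tc x' y' -> i y = j y' -> y = y').
    { intros y; induction (mem_wf y) as [y _ IH]; intros Hy y' Hy' E.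
      apply set_ext; intros z; split; intros Hz.
      - assert (Zx : tc x z) by (apply tc_mem with y; assumption).
        destruct (proj1 (Dj (i z))) as (z' & Hz' & Ez).
        { apply Di; exists z; auto. }
        rewrite (IH z Hz Zx z' Hz' (eq_sym Ez)).
        apply Rj; auto; rewrite Ez, <- E; apply Ri; auto.
      - assert (Zx : tc x' z) by (apply tc_mem with y'; assumption).
        destruct (proj1 (Di (j z))) as (w & Hw & Ew).
        { apply Dj; exists z; auto. }
        assert (Hwy : w ∈ y).
        { apply Ri; auto; rewrite Ew, E; apply Rj; auto. }
        rewrite <- (IH w Hwy Hw z Zx Ew); exact Hwy. }
    apply set_ext; intros z; split; intros Hz.
    - destruct (proj1 (Bj (i z))) as (z' & Hz' & Ez).
      { apply Bi; exists z; auto. }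
      rewrite (K z (tc_elts x z Hz) z' (tc_elts x' z' Hz') (eq_sym Ez)).
      exact Hz'.
    - destruct (proj1 (Bi (j z))) as (w & Hw & Ew).
      { apply Bj; exists z; auto. }
      rewrite <- (K w (tc_elts x w Hw) z (tc_elts x' z Hz) Ew); exact Hw. }
  exists ((T -> T -> Prop) * ((T -> Prop) * (T -> Prop)))%type.
  exists (fun c => eps (codes (fst c) (fst (snd c)) (snd (snd c)))).
  intros x (mu & (Cmu & g & Hg & Ig & _) & Hmu).
  assert (Hk : forall y, tc x y -> exists t, g y = f t).
  { intros y Hy; apply Hf; exact (proj1 (proj1 Ck) mu Hmu (g y) (Hg y Hy)). }
  assert (Hi : exists i : V -> T, inj_on (tc x) i).
  { destruct (classic (inhabited T)) as [HT|N].
    - pose (i := fun y => epsilon HT (fun t => g y = f t)).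
      assert (Si : forall y, tc x y -> g y = f (i y)).
      { intros y Hy; exact (epsilon_spec HT (fun t => g y = f t) (Hk y Hy)). }
      exists i; intros y z Hy Hz E; apply Ig; auto.
      rewrite (Si y Hy), (Si z Hz), E; reflexivity.
    - destruct (Hf mu Hmu) as [t _]; destruct N; constructor; exact t. }
  destruct Hi as [i Ii].
  exists (fun s t => exists y z, tc x y /\ tc x z /\ i y = s /\ i z = t /\ y ∈ z,
    (fun t => exists y, tc x y /\ i y = t, fun t => exists y, y ∈ x /\ i y = t)).
  simpl.
  match goal with |- x = eps (codes ?R ?D ?B) =>
    assert (Hc : codes R D B x); [|apply (uniq R D B); [exact Hc|]] end.
  - exists i; split; [exact Ii|]; split; [reflexivity|]; split; [reflexivity|].
    intros y z Hy Hz; split; [|intros; exists y, z; auto].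
    intros (y' & z' & Hy' & Hz' & Ey & Ez & H).
    rewrite <- (Ii y' y Hy' Hy Ey), <- (Ii z' z Hz' Hz Ez); exact H.
  - apply eps_spec; exists x; exact Hc.
Qed.

Lemma Hset_omega1 k a : cardinal k -> omega1 ⊆ k -> a ∈ omega1 -> Hset k a.
Proof.
  intros Ck H Ha; apply (Hset_intro k a a Ck (H a Ha)).
  apply injects_sub; intros z Hz; apply tc_transitive; [|exact Hz].
  exact (proj1 (omega1_ord a Ha)).
Qed.

Lemma well_orders_exist A : small A -> exists lt, well_orders A lt.
Proof.
  intros HA; destruct (small_equinum_ordinal A HA) as (a & Oa & E).
  destruct (equinum_sym _ _ E) as (f & Hf & If & _).
  exists (fun x y => f x ∈ f y); split; [|split; [|split]].
  - intros x _; apply mem_irrefl.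
  - intros x y z Hx Hy Hz Hxy Hyz.
    exact (proj1 (ordinal_mem a (f z) Oa (Hf z Hz)) (f y) Hyz (f x) Hxy).
  - intros x y Hx Hy.
    destruct (ord_trich (f x) (f y)) as [H|[H|H]]; auto;
      eapply ordinal_mem; [exact Oa|apply Hf, Hx|exact Oa|apply Hf, Hy].
  - intros B HB [b Hb].
    destruct (mem_min (fun z => exists x, B x /\ f x = z)) as (z & (m & Hm & E') & M).
    { eauto. }
    exists m; split; [exact Hm|]; intros x Hx K; rewrite E' in K.
    apply (M (f x) K); eauto.
Qed.

(** * Clubs and closure under countable-valued finitary functions *)

Lemma countable_or (B B' : V -> Prop) : countable B -> countable B' ->
  countable (fun z => B z \/ B' z).
Proof. rewrite !countable_enumerable; apply enum_or. Qed.

Lemma countable_eq a : countable (fun z => z = a).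
Proof. apply countable_enumerable, enum_eq. Qed.

Lemma countable_and (Q : Prop) (B : V -> Prop) : countable B ->
  countable (fun z => Q /\ B z).
Proof. apply countable_sub; intros z [_ H]; exact H. Qed.

Lemma countable_seq (f : nat -> V) : countable (fun z => exists n, z = f n).
Proof. apply countable_enumerable; exists f; auto. Qed.

Lemma countable_iunion {T} (I : T -> Prop) (Q : T -> V -> Prop) : enumerable I ->
  (forall i, I i -> countable (Q i)) -> countable (fun z => exists i, I i /\ Q i z).
Proof.
  intros HI H; apply countable_enumerable, enum_bigunion.
  - exact V_inhabited.
  - exact HI.
  - intros i Hi; apply countable_enumerable, H, Hi.
Qed.

Lemma countable_list1 (Q : V -> V -> Prop) l : (forall a, countable (Q a)) ->
  countable (fun z => exists a, l = [a] /\ Q a z).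
Proof.
  intros H; destruct l as [|a [|b l]];
    [| |]; try (exists (fun _ => 0); intros z y (c & E & _); discriminate).
  apply countable_sub with (Q a); [|apply H].
  intros z (b & E & Hz); injection E as <-; exact Hz.
Qed.

Lemma countable_list2 (Q : V -> V -> V -> Prop) l : (forall a b, countable (Q a b)) ->
  countable (fun z => exists a b, l = [a; b] /\ Q a b z).
Proof.
  intros H; destruct l as [|a [|b [|c l]]];
    try (exists (fun _ => 0); intros z y (d & e & E & _); discriminate).
  apply countable_sub with (Q a b); [|apply H].
  intros z (d & e & E & Hz); injection E as <- <-; exact Hz.
Qed.

(** [G l] is the countable set of values at the finite sequence [l]. Values outside [A] are ignored,
    so functions may be used without first cutting them down to [A], and several of them are
    combined by a disjunction. *)
Definition closed (A : V -> Prop) (G : list V -> V -> Prop) (x : V) : Prop :=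
  forall l z, Forall (elts x) l -> G l z -> A z -> z ∈ x.

Definition cl (A : V -> Prop) (G : list V -> V -> Prop) (x : V) : Prop :=
  ctbl A x /\ closed A G x.

Lemma closed_or A G G' x :
  closed A (fun l z => G l z \/ G' l z) x <-> closed A G x /\ closed A G' x.
Proof.
  split.
  - intros H; split; intros l z Hl Hz; apply (H l z Hl); auto.
  - intros [H H'] l z Hl [Hz|Hz]; [apply (H l)|apply (H' l)]; assumption.
Qed.

Lemma cl_or A G G' x :
  cl A (fun l z => G l z \/ G' l z) x <-> cl A G x /\ cl A G' x.
Proof. unfold cl; rewrite closed_or; tauto. Qed.

Lemma Forall_union (f : nat -> V -> Prop) (l : list V) :
  (forall n z, f n z -> f (S n) z) -> Forall (fun z => exists n, f n z) l ->
  exists n, Forall (f n) l.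
Proof.
  intros M H; assert (L : forall n m z, n <= m -> f n z -> f m z).
  { intros n m z; induction 1; auto. }
  induction H as [|a l [n Ha] _ [m Hl]]; [exists 0; constructor|].
  exists (max n m); constructor; [apply L with n; [lia|exact Ha]|].
  apply Forall_impl with (2 := Hl); intros z; apply L; lia.
Qed.

Lemma mem_delta x z : z ∈ delta x <-> z ∈ x /\ z ∈ omega1.
Proof. apply mem_cap. Qed.

Lemma delta_omega1 x : countable (elts x) ->
  (forall a b, a ∈ x -> a ∈ omega1 -> b ∈ a -> b ∈ x) -> delta x ∈ omega1.
Proof.
  intros C H; apply omega1_intro.
  - intros a Ha b Hb; apply mem_delta in Ha; destruct Ha as [Ha Oa].
    apply mem_delta; split; [eauto|apply (omega1_trans a Oa b Hb)].
  - apply countable_sub with (elts x); [|exact C].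
    intros z Hz; exact (proj1 (proj1 (mem_delta _ _) Hz)).
  - intros z Hz; exact (proj2 (proj1 (mem_delta _ _) Hz)).
Qed.

Lemma delta_trans x a b : delta x ∈ omega1 -> a ∈ x -> a ∈ omega1 -> b ∈ a ->
  b ∈ x.
Proof.
  intros H Ha Oa Hb.
  apply (mem_delta x b), (proj1 (omega1_ord _ H) a); [|exact Hb].
  apply mem_delta; auto.
Qed.

Lemma closure_exists A G (B : V -> Prop) : (forall z, z ∈ omega1 -> A z) ->
  (forall l, countable (G l)) -> countable B -> (forall z, B z -> A z) ->
  exists y, cl A G y /\ forall z, B z -> z ∈ y.
Proof.
  intros HA HG CB HB.
  (* The extra clause adds all elements of each countable ordinal in the set, which makes its
     [delta] transitive and thus an ordinal. For this, [A] has to contain the countable ordinals. *)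
  pose (G' := fun l z => G l z \/ exists a, l = [a] /\ (a ∈ omega1 /\ z ∈ a)).
  assert (HG' : forall l, countable (G' l)).
  { intros l; apply countable_or; [apply HG|]; apply countable_list1; intros a.
    destruct (classic (a ∈ omega1)) as [H|H].
    - apply countable_and, omega1_countable, H.
    - exists (fun _ => 0); intros z y [K _]; contradiction. }
  pose (Y := fix Y n z := match n with
    | 0 => B z
    | S n => Y n z \/ exists l, Forall (Y n) l /\ (G' l z /\ A z) end).
  assert (YC : forall n, countable (Y n)).
  { induction n as [|n IH]; [exact CB|]; simpl; apply countable_or; [exact IH|].
    apply countable_iunion; [apply enum_list, countable_enumerable, IH|].
    intros l _; apply countable_sub with (G' l); [|apply HG'].
    intros z [H _]; exact H. }
  assert (UC : countable (fun z => exists n, Y n z)).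
  { apply countable_sub with (fun z => exists n, True /\ Y n z).
    - intros z [n H]; eauto.
    - apply countable_iunion; [apply enum_nat|]; auto. }
  assert (YA : forall n z, Y n z -> A z).
  { induction n as [|n IH]; [exact HB|]; intros z [H|(l & _ & _ & H)]; auto. }
  pose proof (mem_setof _ (small_countable _ UC)) as Hy.
  set (y := setof _) in Hy; exists y.
  assert (CL : closed A G' y).
  { intros l z Hl Gz Az.
    destruct (Forall_union Y l) as [n Hn].
    - intros n w H; left; exact H.
    - apply Forall_impl with (2 := Hl); intros w; apply Hy.
    - apply Hy; exists (S n); right; eauto. }
  assert (Cy : countable (elts y)).
  { apply countable_sub with (2 := UC); intros z; apply Hy. }
  split; [split; [split; [|split]|]|].
  - intros z Hz; apply Hy in Hz; destruct Hz as [n Hz]; eauto.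
  - exact Cy.
  - apply delta_omega1; [exact Cy|]; intros a b Ha Oa Hb.
    apply (CL [a] b); [constructor; auto|right; eauto|].
    apply HA, (omega1_trans a Oa b Hb).
  - intros l z Hl Gz; apply (CL l z Hl); left; exact Gz.
  - intros z Hz; apply Hy; exists 0; exact Hz.
Qed.

Lemma ctbl_extend A (B : V -> Prop) : (forall z, z ∈ omega1 -> A z) ->
  countable B -> (forall z, B z -> A z) ->
  exists y, ctbl A y /\ forall z, B z -> z ∈ y.
Proof.
  intros HA CB HB.
  destruct (closure_exists A (fun _ _ => False) B HA) as (y & [H _] & K); eauto.
  intros l; exists (fun _ => 0); intros z w [].
Qed.

Lemma club_cl A G : (forall z, z ∈ omega1 -> A z) ->
  (forall l, countable (G l)) -> club A (cl A G).
Proof.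
  intros HA HG; split; [intros x [H _]; exact H|]; split.
  - intros x (H1 & H2 & _).
    apply (closure_exists A G (elts x)); assumption.
  - intros f u Hf Mf U.
    assert (Cu : countable (elts u)).
    { apply countable_sub with (fun z => exists n, True /\ z ∈ f n).
      - intros z Hz; apply U in Hz; destruct Hz as [n Hn]; eauto.
      - apply countable_iunion; [apply enum_nat|]; intros n _; apply (Hf n). }
    split; [split; [|split]|].
    + intros z Hz; apply U in Hz; destruct Hz as [n Hn].
      exact (proj1 (proj1 (Hf n)) z Hn).
    + exact Cu.
    + apply delta_omega1; [exact Cu|]; intros a b Ha Oa Hb.
      apply U in Ha; destruct Ha as [n Hn]; apply U; exists n.
      apply delta_trans with a; try assumption; apply (Hf n).
    + intros l z Hl Gz Az; destruct (Forall_union (fun n z => z ∈ f n) l) as [n Hn].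
      * intros n w; apply Mf.
      * apply Forall_impl with (2 := Hl); intros w; apply U.
      * apply U; exists n; apply (proj2 (Hf n) l); assumption.
Qed.

(* Kueker's theorem: assign to finite sequences [l] members [M l] of [C],
   increasing along initial segments.  A set closed under [l |-> M l] on [A']
   is the trace of the union of the chain given by an enumeration of it. *)
Lemma club_trace A A' C : (forall z, z ∈ omega1 -> A' z) ->
  (forall z, A' z -> A z) -> club A C ->
  exists G, (forall l, countable (G l)) /\
    forall x, cl A' G x -> exists M, C M /\ forall z, z ∈ x <-> z ∈ M /\ A' z.
Proof.
  intros HA' HA (C1 & C2 & C3).
  pose (ch := fun B : V -> Prop => eps (fun y => C y /\ forall z, B z -> z ∈ y)).
  assert (Hch : forall B, countable B -> (forall z, B z -> A z) ->
    C (ch B) /\ forall z, B z -> z ∈ ch B).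
  { intros B CB HB; apply (eps_spec (fun y => C y /\ forall z, B z -> z ∈ y)).
    destruct (ctbl_extend A B) as (x & Hx & K); auto.
    destruct (C2 x Hx) as (y & Cy & Hy); exists y; split; auto. }
  pose (M := fix M (l : list V) := match l with
    | [] => ch (fun _ => False)
    | a :: l => ch (fun z => z = a \/ z ∈ M l) end).
  assert (HM0 : C (M [])).
  { apply Hch; [|intros z []]; exists (fun _ => 0); intros z w []. }
  assert (HM : forall a l, A a -> C (M l) ->
    C (M (a :: l)) /\ a ∈ M (a :: l) /\ M l ⊆ M (a :: l)).
  { intros a l Ha Cl.
    destruct (Hch (fun z => z = a \/ z ∈ M l)) as [H1 H2].
    - apply countable_or; [apply countable_eq|apply (C1 _ Cl)].
    - intros z [->|Hz]; [exact Ha|exact (proj1 (C1 _ Cl) z Hz)].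
    - split; [exact H1|]; split; [apply H2; auto|]; intros z Hz; apply H2; auto. }
  assert (HMl : forall l, Forall A l -> C (M l)).
  { induction 1 as [|a l Ha Hl IH]; [exact HM0|apply HM; assumption]. }
  (* The clause [z = emp] makes every closed [x] nonempty, so that an enumeration of [x] can be
     corrected to one, [e'], with all terms in [x]. *)
  exists (fun l z => z = emp \/ (Forall A l /\ z ∈ M l)); split.
  - intros l; apply countable_or; [apply countable_eq|].
    destruct (classic (Forall A l)) as [H|H].
    + apply countable_and, (C1 _ (HMl l H)).
    + exists (fun _ => 0); intros z w [K _]; contradiction.
  - intros x [(X1 & X2 & X3) X4].
    assert (E0 : emp ∈ x).
    { apply (X4 [] emp); [constructor|auto|apply HA', emp_omega1]. }
    apply countable_enumerable in X2; destruct X2 as [e He].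
    pose (e' := fun n => if excluded_middle_informative (e n ∈ x) then e n else emp).
    assert (He' : forall n, e' n ∈ x).
    { intros n; unfold e'; destruct (excluded_middle_informative _); auto. }
    pose (s := fix s n := match n with 0 => [] | S n => e' n :: s n end).
    assert (Sx : forall n, Forall (elts x) (s n)).
    { induction n as [|n IH]; [constructor|]; constructor; [apply He'|exact IH]. }
    assert (SA : forall n, Forall A (s n)).
    { intros n; apply Forall_impl with (2 := Sx n); intros z Hz; apply HA, X1, Hz. }
    exists (union (fun n => M (s n))); split.
    + apply C3 with (fun n => M (s n)).
      * intros n; apply HMl, SA.
      * intros n; refine (proj2 (proj2 (HM (e' n) (s n) _ _))); [apply HA, X1, He'|apply HMl, SA].
      * intros z; apply mem_union.
    + intros z; rewrite mem_union; split.
      * intros Hz; split; [|apply X1, Hz].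
        destruct (He z Hz) as [n Hn]; exists (S n).
        replace z with (e' n).
        -- refine (proj1 (proj2 (HM (e' n) (s n) _ _))); [apply HA, X1, He'|apply HMl, SA].
        -- unfold e'; rewrite <- Hn; destruct (excluded_middle_informative _);
             [reflexivity|contradiction].
      * intros [[n Hn] Az]; apply (X4 (s n)); auto.
Qed.

Lemma club_contains_cl A C : (forall z, z ∈ omega1 -> A z) -> club A C ->
  exists G, (forall l, countable (G l)) /\ forall x, cl A G x -> C x.
Proof.
  intros HA HC; destruct (club_trace A A C HA (fun _ h => h) HC) as (G & HG & H).
  exists G; split; [exact HG|]; intros x Hx.
  destruct (H x Hx) as (M & CM & E); replace x with M; [exact CM|].
  apply set_ext; intros z; rewrite E; split; [|tauto].
  intros Hz; split; [exact Hz|]; apply HC in CM; apply CM, Hz.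
Qed.

(** * Spanning transfers to arbitrary index sets *)

Definition img (h : V -> V) (x : V) : V := setof (fun z => exists w, w ∈ x /\ z = h w).

Lemma mem_img h x z : z ∈ img h x <-> exists w, w ∈ x /\ z = h w.
Proof. revert z; apply mem_setof, (small_image h (elts x)), small_elts. Qed.

Lemma countable_image (h : V -> V) (B : V -> Prop) : countable B ->
  countable (fun z => exists w, B w /\ z = h w).
Proof.
  rewrite !countable_enumerable; intros H.
  apply (enum_image h B); [exact H|]; auto.
Qed.

(** Besides translating [G] along [h], with inverse [g], the closure makes a
    set [u] and its translate [img g u] agree on the intersection of [A] and
    [B]. *)
Definition transport (A : V -> Prop) (h g : V -> V) (G : list V -> V -> Prop)
    (l : list V) (z : V) : Prop :=
  (exists w, (G (map g l) w /\ A w) /\ z = h w) \/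
  exists a, l = [a] /\ (z = g a \/ z = h a).

Lemma countable_transport A h g G : (forall l, countable (G l)) ->
  forall l, countable (transport A h g G l).
Proof.
  intros HG l; apply countable_or.
  - apply (countable_image h (fun w => G (map g l) w /\ A w)).
    apply countable_sub with (2 := HG (map g l)); intros w [H _]; exact H.
  - apply (countable_list1 (fun a z => z = g a \/ z = h a)).
    intros a; apply countable_or; apply countable_eq.
Qed.

Lemma delta_ext x y : (forall z, z ∈ omega1 -> (z ∈ x <-> z ∈ y)) ->
  delta x = delta y.
Proof.
  intros H; apply set_ext; intros z; rewrite !mem_delta.
  split; intros [K L]; (split; [apply H|]; assumption).
Qed.

(** The bijection [h] need not fix the elements of ω1 or κ. Agreement on the intersection of [A] and
    [B], which contains them in the application, is what preserves [delta] and the trace on κ. *)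
Lemma cl_transport A B h g G u :
  (forall z, z ∈ omega1 -> A z) -> (forall z, z ∈ omega1 -> B z) ->
  (forall w, A w -> B (h w) /\ g (h w) = w) ->
  (forall z, B z -> A (g z) /\ h (g z) = z) ->
  cl B (transport A h g G) u ->
  cl A G (img g u) /\ forall z, A z -> B z -> (z ∈ img g u <-> z ∈ u).
Proof.
  intros OA OB Hh Hg [(U1 & U2 & U3) U4].
  assert (E : forall z, A z -> B z -> (z ∈ img g u <-> z ∈ u)).
  { intros z Az Bz; rewrite mem_img; split.
    - intros (a & Ha & ->); apply (U4 [a]); [constructor; auto| |exact Bz].
      right; eauto.
    - intros Hz; exists (h z); split; [|symmetry; apply Hh, Az].
      apply (U4 [z]); [constructor; auto|right; eauto|apply Hh, Az]. }
  split; [|exact E]; split; [split; [|split]|].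
  - intros z Hz; apply mem_img in Hz; destruct Hz as (a & Ha & ->).
    apply Hg, U1, Ha.
  - apply countable_sub with (fun z => exists w, w ∈ u /\ z = g w).
    + intros z; apply mem_img.
    + apply (countable_image g (elts u)), U2.
  - rewrite (delta_ext _ u); [exact U3|]; intros z Hz; apply E; auto.
  - intros l w Hl Gw Aw; apply mem_img; exists (h w); split; [|symmetry; apply Hh, Aw].
    apply (U4 (map h l)).
    + clear Gw; induction Hl as [|a l Ha Hl IH]; constructor; [|exact IH].
      apply mem_img in Ha; destruct Ha as (b & Hb & ->).
      rewrite (proj2 (Hg b (U1 b Hb))); exact Hb.
    + left; exists w; split; [split; [|exact Aw]|reflexivity].
      rewrite map_map, map_ext_in with (g := fun z => z); [rewrite map_id; exact Gw|].
      intros a Ha; rewrite Forall_forall in Hl; apply Hh.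
      apply Hl, mem_img in Ha; destruct Ha as (b & Hb & ->); apply Hg, U1, Hb.
    + apply Hh, Aw.
Qed.

(** Allows spanning to be used on a superset of H_λ instead of a cardinal. The club [C] is carried
    from [A] to its cardinality [L], spanning is applied there, and the resulting club is carried
    back with [h] and [g] exchanged. *)
Lemma spanning_class kappa S A : cardinal kappa -> omega1 ⊆ kappa -> small A ->
  (forall z, z ∈ kappa -> A z) -> spanning kappa S ->
  forall C, club A C -> exists D, club A D /\
    forall x, D x -> exists y, C y /\ omega1_extension x y /\ S (cap y kappa).
Proof.
  intros Ck Ok SA KA HS C HC.
  destruct (cardinality_exists A SA) as (L & CL & h & Hh & Ih & Jh).
  assert (KL : kappa ⊆ L).
  { apply cardinal_incl; [exact CL|exact Ck|].
    apply injects_trans with A; [apply injects_sub; exact KA|].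
    exists h; auto. }
  pose (g := fun y => eps (fun x => A x /\ h x = y)).
  assert (Hg : forall y, elts L y -> A (g y) /\ h (g y) = y).
  { intros y Hy; exact (eps_spec (fun x => A x /\ h x = y) (Jh y Hy)). }
  assert (Hgh : forall x, A x -> elts L (h x) /\ g (h x) = x).
  { intros x Hx; split; [auto|]; apply Ih; [apply Hg; auto|exact Hx|].
    apply Hg; auto. }
  assert (OA : forall z, z ∈ omega1 -> A z) by auto.
  assert (OL : forall z, z ∈ omega1 -> elts L z) by (intros z Hz; apply KL; auto).
  destruct (club_contains_cl A C OA HC) as (G & HG & GC).
  destruct (HS L CL KL (cl (elts L) (transport A h g G))) as (D & HD & K).
  { apply club_cl; [exact OL|]; apply countable_transport, HG. }
  destruct (club_contains_cl _ D OL HD) as (G2 & HG2 & G2D).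
  exists (cl A (transport (elts L) g h G2)); split.
  { apply club_cl; [exact OA|]; apply countable_transport, HG2. }
  intros x Hx.
  destruct (cl_transport (elts L) A g h G2 x OL OA Hg Hgh Hx) as [Hu Eu].
  destruct (K _ (G2D _ Hu)) as (v & Hv & [I1 I2] & Sv).
  destruct (cl_transport A (elts L) h g G v OA OL Hgh Hg Hv) as [Hy Ey].
  exists (img g v); split; [apply GC, Hy|]; split; [split|].
  - intros z Hz; apply mem_img; exists (h z); split.
    + apply I1, mem_img; eauto.
    + symmetry; apply Hgh, Hx, Hz.
  - rewrite (delta_ext x (img h x)), I2; [apply delta_ext|]; intros z Hz; symmetry.
    + apply Ey; auto.
    + apply Eu; [apply OL|]; auto.
  - replace (cap (img g v) kappa) with (cap v kappa); [exact Sv|].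
    apply set_ext; intros z; rewrite !mem_cap.
    split; intros [H1 H2]; (split; [|exact H2]); apply Ey; auto; apply KL; auto.
Qed.

(** * Conditions of [P_S] *)

Definition le (a g : V) : Prop := a ∈ g \/ a = g.

Lemma le_antisym a b : le a b -> le b a -> a = b.
Proof.
  intros [H|H] [K|K]; auto; destruct (mem_asym a b H K).
Qed.

Lemma le_trans_ord a b c : ordinal c -> le a b -> le b c -> le a c.
Proof.
  intros Oc [H| ->] [K| ->]; unfold le; auto; left; exact (proj1 Oc b K a H).
Qed.

Lemma ord_le_incl a b : ordinal a -> ordinal b -> (le a b <-> a ⊆ b).
Proof.
  intros Oa Ob; split.
  - intros [H| ->]; [exact (proj1 Ob a H)|apply incl_refl].
  - apply ord_incl_eq; assumption.
Qed.

Lemma le_omega1 a b : b ∈ omega1 -> le a b -> a ∈ omega1.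
Proof. intros Hb [H| ->]; [exact (omega1_trans b Hb a H)|exact Hb]. Qed.

Definition mkseq (g : V) (x : V -> V) : V :=
  setof (fun z => exists a, (a ∈ g \/ a = g) /\ z = pair a (x a)).

Lemma is_seq_mkseq g x : is_seq g x (mkseq g x).
Proof.
  unfold is_seq, mkseq; apply mem_setof, small_image, small_or;
    [apply small_elts|apply small_eq].
Qed.

(** The last index of [p], not its order type: the domain of [p] consists of the [a] with
    [le a (len p)]. *)
Definition len (p : V) : V := eps (fun g => exists x, is_seq g x p).

Definition at_ (p a : V) : V := eps (fun v => pair a v ∈ p).

Definition top (p : V) : V := at_ p (len p).

Lemma seq_mem g x p a v : is_seq g x p -> (pair a v ∈ p <-> le a g /\ v = x a).
Proof.
  intros H; rewrite (H (pair a v)); split.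
  - intros (b & Hb & E); apply pair_inj in E; destruct E as [-> ->]; auto.
  - intros [Ha ->]; eauto.
Qed.

Lemma seq_at g x p a : is_seq g x p -> le a g -> at_ p a = x a.
Proof.
  intros H Ha; apply (seq_mem g x p a _ H), (eps_spec (fun v => pair a v ∈ p)).
  exists (x a); apply (seq_mem g x p a _ H); auto.
Qed.

Lemma seq_len g x p : is_seq g x p -> len p = g.
Proof.
  intros H; destruct (eps_spec (fun g => exists x, is_seq g x p)) as [y K];
    [eauto|]; fold (len p) in K.
  assert (E : forall a, le a (len p) <-> le a g).
  { intros a; split; intros Ha.
    - apply (seq_mem g x p a (y a) H), (seq_mem _ y p a _ K); auto.
    - apply (seq_mem _ y p a (x a) K), (seq_mem g x p a _ H); auto. }
  apply le_antisym; apply E; right; reflexivity.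
Qed.

(** The requirements of [P_cond] on a function up to index [g], separated from the coding as a set
    of pairs. *)
Definition good (S : V -> Prop) (g : V) (x : V -> V) : Prop :=
  (forall a, le a g -> S (x a)) /\
  (forall a b, le b g -> a ∈ b -> x a ⊆ x b /\ delta (x a) ∈ delta (x b)) /\
  (forall a, le a g -> limit a -> forall z, z ∈ x a <-> exists b, b ∈ a /\ z ∈ x b).

Lemma le_lt_trans a b g : ordinal g -> le b g -> a ∈ b -> le a g.
Proof. intros O H K; apply le_trans_ord with b; [exact O|left|]; assumption. Qed.

Lemma good_ext S g x y : ordinal g -> (forall a, le a g -> x a = y a) ->
  good S g x -> good S g y.
Proof.
  intros O E (H1 & H2 & H3); split; [|split].
  - intros a Ha; rewrite <- (E a Ha); auto.
  - intros a b Hb Hab; rewrite <- (E b Hb), <- (E a); [auto|].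
    apply le_lt_trans with b; assumption.
  - intros a Ha La z; rewrite <- (E a Ha), (H3 a Ha La).
    split; intros (b & Hb & Hz); exists b; (split; [exact Hb|]);
      [rewrite <- (E b)|rewrite (E b)]; try exact Hz; apply le_lt_trans with a; auto.
Qed.

Lemma P_cond_mkseq S g x : g ∈ omega1 -> good S g x -> P_cond S (mkseq g x).
Proof.
  intros Hg (H1 & H2 & H3); exists g, x; split; [exact Hg|]; split.
  - apply is_seq_mkseq.
  - auto.
Qed.

Lemma P_cond_inv S p : P_cond S p ->
  len p ∈ omega1 /\ is_seq (len p) (at_ p) p /\ good S (len p) (at_ p).
Proof.
  intros (g & x & Hg & Hx & H1 & H2 & H3).
  rewrite (seq_len g x p Hx); split; [exact Hg|]; split.
  - intros z; rewrite (Hx z); split; intros (a & Ha & ->); exists a;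
      (split; [exact Ha|]); rewrite (seq_at g x p a Hx Ha); reflexivity.
  - apply good_ext with x; [apply omega1_ord, Hg| |split; auto].
    intros a Ha; symmetry; apply (seq_at g x); assumption.
Qed.

Lemma len_omega1 S p : P_cond S p -> len p ∈ omega1.
Proof. intros H; apply (P_cond_inv S p H). Qed.

Lemma P_good S p : P_cond S p -> good S (len p) (at_ p).
Proof. intros H; apply (P_cond_inv S p H). Qed.

Lemma len_mkseq g x : len (mkseq g x) = g.
Proof. apply seq_len with x, is_seq_mkseq. Qed.

Lemma at_mkseq g x a : le a g -> at_ (mkseq g x) a = x a.
Proof. apply seq_at, is_seq_mkseq. Qed.

Lemma end_extends_inv q p : end_extends q p ->
  len p ∈ omega1 /\ len q ∈ omega1 /\ len p ⊆ len q /\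
  (forall a, le a (len p) -> at_ q a = at_ p a).
Proof.
  intros (g & g' & x & Hg & Hg' & I & Hp & Hq).
  rewrite (seq_len g x p Hp), (seq_len g' x q Hq).
  split; [exact Hg|]; split; [exact Hg'|]; split; [exact I|].
  intros a Ha; rewrite (seq_at g x p a Hp Ha); apply (seq_at g' x q a Hq).
  apply le_trans_ord with g; [apply omega1_ord, Hg'|exact Ha|].
  apply ord_le_incl; [apply omega1_ord|apply omega1_ord|]; assumption.
Qed.

Lemma end_extends_intro S q p : P_cond S p -> P_cond S q -> len p ⊆ len q ->
  (forall a, le a (len p) -> at_ q a = at_ p a) -> end_extends q p.
Proof.
  intros Hp Hq I E.
  destruct (P_cond_inv S p Hp) as (Op & Sp & _).
  destruct (P_cond_inv S q Hq) as (Oq & Sq & _).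
  exists (len p), (len q), (at_ q).
  split; [exact Op|]; split; [exact Oq|]; split; [exact I|]; split; [|exact Sq].
  intros z; rewrite (Sp z); split; intros (a & Ha & ->); exists a;
    (split; [exact Ha|]); rewrite (E a Ha); reflexivity.
Qed.

Lemma end_extends_refl S p : P_cond S p -> end_extends p p.
Proof. intros H; apply (end_extends_intro S); auto; apply incl_refl. Qed.

Lemma end_extends_trans r q p :
  end_extends r q -> end_extends q p -> end_extends r p.
Proof.
  intros (h & h' & y & Hh & Hh' & J & Kq & Kr) (g & g' & x & Hg & Hg' & I & Lp & Lq).
  assert (E : h = g') by (rewrite <- (seq_len h y q Kq); apply (seq_len g' x q Lq)).
  subst h; exists g, h', y; split; [exact Hg|]; split; [exact Hh'|].
  split; [exact (incl_trans g g' h' I J)|]; split; [|exact Kr].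
  assert (Exy : forall a, le a g -> x a = y a).
  { intros a Ha; assert (Ha' : le a g').
    { apply le_trans_ord with g; [apply omega1_ord, Hg'|exact Ha|].
      apply ord_le_incl; [apply omega1_ord|apply omega1_ord|]; assumption. }
    rewrite <- (seq_at g' x q a Lq Ha'); apply (seq_at g' y q a Kq Ha'). }
  intros z; rewrite (Lp z); split; intros (a & Ha & ->); exists a;
    (split; [exact Ha|]); rewrite (Exy a Ha); reflexivity.
Qed.

Lemma ext_cond_le S q p : P_cond S p -> P_cond S q -> end_extends q p ->
  le (len p) (len q).
Proof.
  intros Hp Hq H; apply ord_le_incl; [apply omega1_ord|apply omega1_ord|].
  - apply len_omega1 with S, Hp.
  - apply len_omega1 with S, Hq.
  - apply (end_extends_inv q p H).
Qed.

Lemma good_mono S g x a b : good S g x -> le b g -> le a b -> x a ⊆ x b.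
Proof.
  intros (_ & H & _) Hb [Ha| ->]; [exact (proj1 (H a b Hb Ha))|apply incl_refl].
Qed.

Lemma top_mono S q p : P_cond S p -> P_cond S q -> end_extends q p ->
  top p ⊆ top q.
Proof.
  intros Hp Hq H; destruct (end_extends_inv q p H) as (_ & _ & _ & E).
  unfold top; rewrite <- (E (len p)) by (right; reflexivity).
  apply (good_mono S (len q)); [apply P_good, Hq|right; reflexivity|].
  apply (ext_cond_le S); assumption.
Qed.

Lemma top_S S p : P_cond S p -> S (top p).
Proof. intros H; apply (proj1 (P_good S p H)); right; reflexivity. Qed.

(** The two ways of prolonging a sequence of members of [S] by a last member
    [x]: for [g] a successor any large [x] works, for [g] a limit [x] has to be
    the union of the previous members. *)
Definition snoc (g : V) (y : V -> V) (x : V) (a : V) : V :=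
  if excluded_middle_informative (a ∈ g) then y a else x.

Lemma snoc_mem g y x a : a ∈ g -> snoc g y x a = y a.
Proof.
  intros H; unfold snoc; destruct (excluded_middle_informative _);
    [reflexivity|contradiction].
Qed.

Lemma snoc_last g y x : snoc g y x g = x.
Proof.
  unfold snoc; destruct (excluded_middle_informative _) as [H|H];
    [destruct (mem_irrefl g H)|reflexivity].
Qed.

Lemma good_snoc (S : V -> Prop) g y x : ordinal g -> S x ->
  (forall b, b ∈ g -> good S b y) ->
  (forall b, b ∈ g -> y b ⊆ x /\ delta (y b) ∈ delta x) ->
  (limit g -> forall z, z ∈ x -> exists b, b ∈ g /\ z ∈ y b) ->
  good S g (snoc g y x).
Proof.
  intros Og Sx Hy Hx Hl; split; [|split].
  - intros a [Ha| ->]; [|rewrite snoc_last; exact Sx].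
    rewrite snoc_mem by exact Ha; apply (Hy a Ha); right; reflexivity.
  - intros a b [Hb| ->] Ha.
    + rewrite (snoc_mem g y x b) by exact Hb.
      rewrite (snoc_mem g y x a) by exact (proj1 Og b Hb a Ha).
      apply (Hy b Hb); [right; reflexivity|exact Ha].
    + rewrite snoc_last, (snoc_mem g y x a) by exact Ha; auto.
  - intros a [Ha| ->] La z.
    + rewrite snoc_mem by exact Ha.
      rewrite (proj2 (proj2 (Hy a Ha)) a (or_intror eq_refl) La z).
      split; intros (b & Hb & Hz); exists b; (split; [exact Hb|]);
        [rewrite snoc_mem|rewrite snoc_mem in Hz]; auto;
        exact (proj1 Og a Ha b Hb).
    + rewrite snoc_last; split.
      * intros Hz; destruct (Hl La z Hz) as (b & Hb & Hz'); exists b.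
        rewrite snoc_mem; auto.
      * intros (b & Hb & Hz); rewrite snoc_mem in Hz by exact Hb.
        apply (Hx b Hb), Hz.
Qed.

Lemma good_le S g x b : ordinal g -> good S g x -> le b g -> good S b x.
Proof.
  intros O (H1 & H2 & H3) Hb.
  assert (K : forall a, le a b -> le a g).
  { intros a Ha; apply le_trans_ord with b; assumption. }
  split; [auto|]; split; auto.
Qed.

(** * Density, fusion and distributivity of P_S *)

(** A fixed choice of extension, so that sets can be closed under it. It is strictly longer than
    [p], which makes the lengths in a fusion increase strictly. *)
Definition add (S : V -> Prop) (p a : V) : V :=
  eps (fun q => P_cond S q /\ end_extends q p /\ len p ∈ len q /\ a ∈ top q).

(** The stationary set [S] meets the club of suitable last members. The new index is a successor, so
    continuity demands nothing there. *)
Lemma add_spec kappa S p a : omega1 ⊆ kappa -> stationary (elts kappa) S ->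
  P_cond S p -> a ∈ kappa ->
  P_cond S (add S p a) /\ end_extends (add S p a) p /\ len p ∈ len (add S p a) /\
  a ∈ top (add S p a).
Proof.
  intros HO [HS1 HS2] Hp Ha.
  apply (eps_spec (fun q => P_cond S q /\ end_extends q p /\ len p ∈ len q /\
    a ∈ top q)).
  destruct (HS1 _ (top_S S p Hp)) as (T1 & T2 & T3).
  (* Having the ordinal [delta (top p)] as an element makes [delta x] strictly larger than it. *)
  pose (G := fun (l : list V) z => (z = a \/ z = delta (top p)) \/ z ∈ top p).
  destruct (HS2 (cl (elts kappa) G)) as (x & [Cx Gx] & Sx).
  { apply club_cl; [exact HO|]; intros l; apply countable_or; [|exact T2].
    apply countable_or; apply countable_eq. }
  assert (X : forall z, z ∈ kappa -> G [] z -> z ∈ x).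
  { intros z Hz Gz; apply (Gx [] z); [constructor|exact Gz|exact Hz]. }
  assert (Xt : top p ⊆ x) by (intros z Hz; apply X; [apply T1|right]; exact Hz).
  assert (Xd : delta (top p) ∈ delta x).
  { apply mem_delta; split; [|exact T3]; apply X; [apply HO, T3|left; auto]. }
  pose proof (len_omega1 S p Hp) as Op.
  pose proof (P_good S p Hp) as Gp.
  assert (Sl : forall b, b ∈ succ (len p) -> le b (len p)).
  { intros b Hb; apply mem_succ, Hb. }
  assert (Hq : P_cond S (mkseq (succ (len p)) (snoc (succ (len p)) (at_ p) x))).
  { apply P_cond_mkseq; [apply succ_omega1, Op|].
    apply good_snoc.
    - apply omega1_ord, succ_omega1, Op.
    - exact Sx.
    - intros b Hb; apply good_le with (len p); [apply omega1_ord, Op|exact Gp|auto].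
    - intros b Hb; apply Sl in Hb.
      assert (K : at_ p b ⊆ x).
      { apply incl_trans with (top p); [|exact Xt].
        exact (good_mono S (len p) (at_ p) b (len p) Gp (or_intror eq_refl) Hb). }
      split; [exact K|]; destruct Hb as [Hb| ->]; [|exact Xd].
      assert (O : ordinal (delta x)) by apply omega1_ord, Cx.
      apply (proj1 O (delta (top p)) Xd).
      apply (proj1 (proj2 Gp) b (len p)); [right; reflexivity|exact Hb].
    - intros (_ & _ & L).
      destruct (L (len p)) as (c & Hc & K); [apply mem_succ; auto|].
      apply mem_succ in Hc; destruct Hc as [Hc| ->].
      + destruct (mem_asym _ _ Hc K).
      + destruct (mem_irrefl _ K). }
  exists (mkseq (succ (len p)) (snoc (succ (len p)) (at_ p) x)).
  split; [exact Hq|].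
  unfold top; rewrite len_mkseq; split; [|split].
  - apply (end_extends_intro S); try assumption.
    + rewrite len_mkseq; intros z Hz; apply mem_succ; auto.
    + intros b Hb; assert (Hb' : b ∈ succ (len p)) by (apply mem_succ, Hb).
      rewrite at_mkseq by (left; exact Hb'); apply snoc_mem, Hb'.
  - apply mem_succ; auto.
  - rewrite at_mkseq by (right; reflexivity); rewrite snoc_last.
    apply X; [exact Ha|left; auto].
Qed.

(* The conditions [s n] below have length cofinal in [g], and the union of
   their last members is [x]; hence [x] may be put on top of their union. *)
Lemma fusion kappa S (N : V -> Prop) x (m : nat -> V -> V) p0 :
  omega1 ⊆ kappa -> stationary (elts kappa) S -> S x ->
  (forall z, z ∈ x <-> N z /\ z ∈ kappa) ->
  N emp -> N p0 -> P_cond S p0 ->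
  (forall p z, P_cond S p -> N p -> z ∈ top p -> N z) ->
  (forall p a, P_cond S p -> N p -> N a -> a ∈ kappa -> N (add S p a)) ->
  (forall n p, P_cond S p -> N p ->
    N (m n p) /\ P_cond S (m n p) /\ end_extends (m n p) p) ->
  exists q, P_cond S q /\ end_extends q p0 /\
    forall n, exists p, N p /\ P_cond S p /\ end_extends q (m n p).
Proof.
  intros HO HS Sx Ex N0 Np0 Hp0 Ntop Nadd Nm.
  destruct (proj1 HS x Sx) as (_ & X2 & X3).
  assert (K0 : emp ∈ kappa) by apply HO, emp_omega1.
  destruct (proj1 (countable_enumerable _) X2) as [e He].
  pose (e' := fun n => if excluded_middle_informative (e n ∈ x) then e n else emp).
  assert (He' : forall n, e' n ∈ x).
  { intros n; unfold e'; destruct (excluded_middle_informative _); auto.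
    apply Ex; auto. }
  (* Each step first catches the next element of [x] and lengthens the condition, then carries out
     the task [m n]. *)
  pose (s := fix s n := match n with
    | 0 => p0 | Datatypes.S n => m n (add S (s n) (e' n)) end).
  assert (Hs : forall n, N (s n) /\ P_cond S (s n)).
  { induction n as [|n [IH1 IH2]]; [auto|]; simpl.
    assert (Hn : N (e' n) /\ e' n ∈ kappa) by apply Ex, He'.
    destruct (add_spec kappa S (s n) (e' n)) as (A1 & A2 & A3 & A4); try tauto.
    destruct (Nm n (add S (s n) (e' n))) as (M1 & M2 & M3); [exact A1| |auto].
    apply Nadd; tauto. }
  assert (Hadd : forall n, N (add S (s n) (e' n)) /\
    P_cond S (add S (s n) (e' n)) /\ end_extends (add S (s n) (e' n)) (s n) /\
    len (s n) ∈ len (add S (s n) (e' n)) /\ e' n ∈ top (add S (s n) (e' n))).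
  { intros n; assert (Hn : N (e' n) /\ e' n ∈ kappa) by apply Ex, He'.
    split; [apply Nadd; try tauto; apply Hs|].
    apply (add_spec kappa); try tauto; apply Hs. }
  assert (Hm : forall n, end_extends (s (Datatypes.S n)) (add S (s n) (e' n))).
  { intros n; apply Nm; apply Hadd. }
  assert (Hstep : forall n, end_extends (s (Datatypes.S n)) (s n)).
  { intros n; apply end_extends_trans with (add S (s n) (e' n)).
    - apply Hm.
    - apply Hadd. }
  assert (Hchain : forall n k, n <= k -> end_extends (s k) (s n)).
  { induction 1 as [|k Hk IH]; [apply (end_extends_refl S), Hs|].
    apply end_extends_trans with (s k); [apply Hstep|exact IH]. }
  assert (Hlen : forall n, len (s n) ∈ len (s (Datatypes.S n))).
  { intros n; apply (end_extends_inv _ _ (Hm n)), Hadd. }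
  assert (Olen : forall n, len (s n) ∈ omega1).
  { intros n; apply len_omega1 with S, Hs. }
  assert (Htop : forall n, top (s n) ⊆ x).
  { intros n z Hz; apply Ex; split; [apply (Ntop (s n)); auto; apply Hs|].
    destruct (proj1 HS _ (top_S S (s n) (proj2 (Hs n)))) as (T & _); apply T, Hz. }
  pose (g := union (fun n => len (s n))).
  assert (Hg : forall b, b ∈ g <-> exists n, b ∈ len (s n)).
  { intros b; apply mem_union. }
  assert (Og : g ∈ omega1).
  { apply omega1_intro.
    - intros b Hb c Hc; apply Hg in Hb; destruct Hb as [n Hb]; apply Hg; exists n.
      exact (proj1 (omega1_ord _ (Olen n)) b Hb c Hc).
    - apply countable_sub with (fun b => exists n, True /\ b ∈ len (s n)).
      + intros b Hb; apply Hg in Hb; destruct Hb as [n Hb]; eauto.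
      + apply countable_iunion; [apply enum_nat|]; intros n _.
        apply omega1_countable, Olen.
    - intros b Hb; apply Hg in Hb; destruct Hb as [n Hb].
      exact (omega1_trans _ (Olen n) b Hb). }
  pose (y := fun a => at_ (s (epsilon (inhabits 0) (fun n => a ∈ len (s n)))) a).
  assert (Hy : forall n a, a ∈ len (s n) -> y a = at_ (s n) a).
  { intros n a Ha; unfold y.
    pose proof (epsilon_spec (inhabits 0) (fun n => a ∈ len (s n))
      (ex_intro _ n Ha)) as Hk; cbv beta in Hk.
    set (k := epsilon _ _) in *; clearbody k.
    destruct (le_ge_dec n k) as [H|H]; [|symmetry];
      apply (end_extends_inv _ _ (Hchain _ _ H)); left; assumption. }
  assert (Hgood : forall b, b ∈ g -> good S b y).
  { intros b Hb; apply Hg in Hb; destruct Hb as [n Hb].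
    assert (Ob : ordinal b) by (apply omega1_ord, (omega1_trans _ (Olen n) b Hb)).
    apply good_ext with (at_ (s n)); [exact Ob| |].
    - intros a Ha; symmetry; apply Hy.
      destruct Ha as [Ha| ->]; [|exact Hb].
      exact (proj1 (omega1_ord _ (Olen n)) b Hb a Ha).
    - apply good_le with (len (s n)); [apply omega1_ord, Olen| |left; exact Hb].
      apply P_good, Hs. }
  assert (Hq : P_cond S (mkseq g (snoc g y x))).
  { apply P_cond_mkseq; [exact Og|]; apply good_snoc.
    - apply omega1_ord, Og.
    - exact Sx.
    - exact Hgood.
    - intros b Hb; apply Hg in Hb; destruct Hb as [n Hb]; rewrite (Hy n b Hb).
      pose proof (P_good S _ (proj2 (Hs n))) as (_ & Gs & _).
      destruct (Gs b (len (s n)) (or_intror eq_refl) Hb) as [G1 G2].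
      split; [apply incl_trans with (top (s n)); auto|].
      apply mem_delta in G2; apply mem_delta; split; [|apply G2].
      apply (Htop n), G2.
    - intros _ z Hz; destruct (He z Hz) as [n En].
      (* The element [e n] was caught on the way to stage n+1, so it lies in the last member of that
         stage. The index of this member belongs to [g] because stage n+2 is longer. *)
      exists (len (s (Datatypes.S n))).
      assert (L : len (s (Datatypes.S n)) ∈ len (s (Datatypes.S (Datatypes.S n))))
        by apply Hlen.
      split; [apply Hg; eauto|]; rewrite (Hy _ _ L).
      destruct (end_extends_inv _ _ (Hstep (Datatypes.S n))) as (_ & _ & _ & E).
      rewrite E by (right; reflexivity).
      apply (top_mono S _ _ (proj1 (proj2 (Hadd n))) (proj2 (Hs _)) (Hm n)).
      replace z with (e' n); [apply Hadd|].
      unfold e'; rewrite <- En; destruct (excluded_middle_informative _);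
        [reflexivity|contradiction]. }
  assert (Hqs : forall n, end_extends (mkseq g (snoc g y x)) (s n)).
  { intros n; apply (end_extends_intro S); [apply Hs|exact Hq| |].
    - rewrite len_mkseq; intros b Hb; apply Hg; eauto.
    - intros a Ha; destruct (end_extends_inv _ _ (Hstep n)) as (_ & O & _ & E).
      assert (Ha' : a ∈ len (s (Datatypes.S n))).
      { destruct Ha as [Ha| ->]; [|apply Hlen].
        exact (proj1 (omega1_ord _ O) _ (Hlen n) a Ha). }
      assert (Hag : a ∈ g) by (apply Hg; eauto).
      rewrite at_mkseq by (left; exact Hag); rewrite snoc_mem by exact Hag.
      rewrite (Hy _ _ Ha'); apply E, Ha. }
  exists (mkseq g (snoc g y x)); split; [exact Hq|]; split; [exact (Hqs 0)|].
  intros n; exists (add S (s n) (e' n)); split; [apply Hadd|]; split; [apply Hadd|].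
  exact (Hqs (Datatypes.S n)).
Qed.

(** Countably many open dense sets have a common element below [p0], when [m n p] is an extension of
    [p] in the n-th set. By stationarity some [M] closed under all operations that [fusion] uses has
    its trace on κ in [S], and the fusion is done inside [M]. *)
Lemma distributive kappa S (m : nat -> V -> V) p0 :
  omega1 ⊆ kappa -> stationary (elts kappa) S -> P_cond S p0 ->
  (forall n p, P_cond S p -> P_cond S (m n p) /\ end_extends (m n p) p) ->
  exists q, P_cond S q /\ end_extends q p0 /\
    forall n, exists p, P_cond S p /\ end_extends q (m n p).
Proof.
  intros HO HS Hp0 Hm.
  pose (A := fun z => z ∈ kappa \/ P_cond S z).
  pose (G := fun l z => (z = emp \/ z = p0) \/
    (exists p, l = [p] /\ (P_cond S p /\ z ∈ top p \/ exists n, z = m n p)) \/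
    (exists p a, l = [p; a] /\ z = add S p a)).
  destruct (club_trace A (elts kappa) (cl A G)) as (G' & HG' & T).
  { exact HO. }
  { intros z Hz; left; exact Hz. }
  { apply club_cl; [intros z Hz; left; apply HO, Hz|]; intros l.
    apply countable_or; [apply countable_or; apply countable_eq|].
    apply countable_or.
    - apply (countable_list1 (fun p z => P_cond S p /\ z ∈ top p \/
        exists n, z = m n p)); intros p; apply countable_or; [|apply countable_seq].
      destruct (classic (P_cond S p)) as [Hp|Hp].
      + apply countable_and; exact (proj1 (proj2 (proj1 HS _ (top_S S p Hp)))).
      + exists (fun _ => 0); intros z w [K _]; contradiction.
    - apply (countable_list2 (fun p a z => z = add S p a)).
      intros p a; apply countable_eq. }
  destruct (proj2 HS (cl (elts kappa) G')) as (x & Cx & Sx).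
  { apply club_cl; assumption. }
  destruct (T x Cx) as (M & [_ GM] & EM).
  destruct (fusion kappa S (elts M) x m p0) as (q & Q1 & Q2 & Q3);
    try assumption.
  - apply (GM [] emp); [constructor|left; auto|left; apply HO, emp_omega1].
  - apply (GM [] p0); [constructor|left; auto|right; exact Hp0].
  - intros p z Hp Mp Hz; apply (GM [p]).
    + constructor; auto.
    + right; left; eauto.
    + left; destruct (proj1 HS _ (top_S S p Hp)) as [K _]; apply K, Hz.
  - intros p a Hp Mp Ma Ka; apply (GM [p; a]).
    + constructor; [exact Mp|]; constructor; auto.
    + right; right; eauto.
    + right; apply (add_spec kappa); assumption.
  - intros n p Hp Mp; destruct (Hm n p Hp) as [H1 H2]; split; [|auto].
    apply (GM [p]); [constructor; auto|right; left; eauto|right; exact H1].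
  - exists q; split; [exact Q1|]; split; [exact Q2|].
    intros n; destruct (Q3 n) as (p & _ & Hp & E); eauto.
Qed.

(** At limits the union of the members chosen so far may fail to be in [S], so a plain recursion
    breaks down; distributivity handles all elements of [a] at once. *)
Lemma len_dense kappa S a p : omega1 ⊆ kappa -> stationary (elts kappa) S ->
  a ∈ omega1 -> P_cond S p ->
  exists q, P_cond S q /\ end_extends q p /\ a ⊆ len q.
Proof.
  intros HO HS; revert p; induction (mem_wf a) as [a _ IH]; intros p Ha Hp.
  destruct (proj1 (countable_enumerable _) (omega1_countable a Ha)) as [e He].
  pose (Q := fun n p q => P_cond S q /\ end_extends q p /\ e n ⊆ len q).
  pose (m := fun n p =>
    if excluded_middle_informative (e n ∈ a) then eps (Q n p) else p).
  assert (Hm : forall n p, P_cond S p ->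
    (P_cond S (m n p) /\ end_extends (m n p) p) /\
    (e n ∈ a -> e n ⊆ len (m n p))).
  { intros n r Hr; unfold m; destruct (excluded_middle_informative _) as [H|H].
    - destruct (eps_spec (Q n r)) as (Q1 & Q2 & Q3); [|auto].
      apply (IH (e n) H r); [exact (omega1_trans a Ha _ H)|exact Hr].
    - split; [split; [exact Hr|apply (end_extends_refl S), Hr]|contradiction]. }
  destruct (distributive kappa S m p HO HS Hp) as (q & Q1 & Q2 & Q3).
  { intros n r Hr; apply Hm, Hr. }
  assert (K0 : emp ∈ kappa) by apply HO, emp_omega1.
  (* The induction hypothesis gives only [e n ⊆ len q]; one more step turns this into [e n] being an
     element of the length. *)
  destruct (add_spec kappa S q emp HO HS Q1 K0) as (A1 & A2 & A3 & _).
  exists (add S q emp); split; [exact A1|]; split.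
  { apply end_extends_trans with q; assumption. }
  intros b Hb; destruct (He b Hb) as [n ->]; destruct (Q3 n) as (r & Hr & E).
  assert (L : e n ⊆ len q).
  { apply incl_trans with (len (m n r)); [apply Hm; assumption|].
    apply (end_extends_inv _ _ E). }
  pose proof (len_omega1 S _ A1) as OA.
  assert (Oq : ordinal (len q)) by apply omega1_ord, (len_omega1 S _ Q1).
  assert (Ob : ordinal (e n)) by apply omega1_ord, (omega1_trans a Ha _ Hb).
  destruct (proj2 (ord_le_incl _ _ Ob Oq) L) as [K|K].
  - exact (proj1 (omega1_ord _ OA) _ A3 _ K).
  - rewrite K; exact A3.
Qed.

(** * Elementary submodels *)

(** [k] is fuel bounding the depth, and [n] codes a tag and its arguments by iterated pairing. Only
    surjectivity matters, so leftover codes get arbitrary values. *)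
Fixpoint dec_formula (k n : nat) : formula :=
  match k with
  | 0 => FIn 0 0
  | S k =>
      let (t, c) := of_nat n in let (i, d) := of_nat c in let (j, h) := of_nat d in
      match t with
      | 0 => FIn i j
      | 1 => FEq i j
      | 2 => FLt i j
      | 3 => FCond i
      | 4 => FExt i j
      | 5 => FForcesEq i j h
      | 6 => FForcesIn i j h
      | 7 => FNot (dec_formula k c)
      | 8 => FAnd (dec_formula k i) (dec_formula k d)
      | _ => FEx i (dec_formula k d)
      end
  end.

(** Stated for all large [k], because the two halves of a conjunction are decoded with the same
    fuel. *)
Lemma dec_formula_surj phi :
  exists k0, forall k, k0 <= k -> exists n, phi = dec_formula k n.
Proof.
  assert (At : forall t i j h, exists n, forall k,
    dec_formula (S k) n = match t with
      | 0 => FIn i j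
      | 1 => FEq i j
      | 2 => FLt i j
      | 3 => FCond i
      | 4 => FExt i j
      | 5 => FForcesEq i j h
      | 6 => FForcesIn i j h
      | 7 => FNot (dec_formula k (to_nat (i, to_nat (j, h))))
      | 8 => FAnd (dec_formula k i) (dec_formula k (to_nat (j, h)))
      | _ => FEx i (dec_formula k (to_nat (j, h)))
      end).
  { intros t i j h; exists (to_nat (t, to_nat (i, to_nat (j, h)))); intros k.
    cbn [dec_formula]; rewrite !cancel_of_to; reflexivity. }
  assert (Un : forall n, exists j h, n = to_nat (j, h)).
  { intros n; exists (fst (of_nat n)), (snd (of_nat n)).
    rewrite <- surjective_pairing, cancel_to_of; reflexivity. }
  assert (Lift : forall k0 (Q : nat -> Prop), (forall k, k0 <= k -> Q (S k)) ->
    exists k0, forall k, k0 <= k -> Q k).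
  { intros k0 Q H; exists (S k0); intros [|k] Hk; [lia|apply H; lia]. }
  induction phi as [i j|i j|i j|i|i j|i j h|i j h|phi [k1 IH]
    |phi [k1 IH1] psi [k2 IH2]|i phi [k1 IH]].
  - apply (Lift 0); intros k _; destruct (At 0 i j 0) as [n H]; exists n; auto.
  - apply (Lift 0); intros k _; destruct (At 1 i j 0) as [n H]; exists n; auto.
  - apply (Lift 0); intros k _; destruct (At 2 i j 0) as [n H]; exists n; auto.
  - apply (Lift 0); intros k _; destruct (At 3 i 0 0) as [n H]; exists n; auto.
  - apply (Lift 0); intros k _; destruct (At 4 i j 0) as [n H]; exists n; auto.
  - apply (Lift 0); intros k _; destruct (At 5 i j h) as [n H]; exists n; auto.
  - apply (Lift 0); intros k _; destruct (At 6 i j h) as [n H]; exists n; auto.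
  - apply (Lift k1); intros k Hk; destruct (IH k Hk) as [m ->].
    destruct (Un m) as (i & c & ->), (Un c) as (j & h & ->).
    destruct (At 7 i j h) as [n H]; exists n; auto.
  - apply (Lift (k1 + k2)); intros k Hk.
    destruct (IH1 k) as [i ->]; [lia|]; destruct (IH2 k) as [m ->]; [lia|].
    destruct (Un m) as (j & h & ->).
    destruct (At 8 i j h) as [n H]; exists n; auto.
  - apply (Lift k1); intros k Hk; destruct (IH k Hk) as [m ->].
    destruct (Un m) as (j & h & ->).
    destruct (At 9 i j h) as [n H]; exists n; auto.
Qed.

Lemma enum_formula : enumerable (fun _ : formula => True).
Proof.
  exists (fun n => dec_formula (fst (of_nat n)) (snd (of_nat n))); intros phi _.
  destruct (dec_formula_surj phi) as [k H]; destruct (H k (le_n k)) as [n ->].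
  exists (to_nat (k, n)); rewrite cancel_of_to; reflexivity.
Qed.

(** Lets an infinite environment be replaced by a finite list, the kind of argument that the
    functions defining a closure take. *)
Lemma sat_local P lt M phi : exists k, forall e e',
  (forall n, n < k -> e n = e' n) -> (sat P lt M phi e <-> sat P lt M phi e').
Proof.
  induction phi as [i j|i j|i j|i|i j|i j h|i j h|phi [k1 IH]
    |phi [k1 IH1] psi [k2 IH2]|i phi [k1 IH]].
  all: try (exists (S (i + j)); intros e e' H; simpl;
    rewrite (H i) by lia; rewrite (H j) by lia; reflexivity).
  - exists (S i); intros e e' H; simpl; rewrite (H i) by lia; reflexivity.
  - exists (S (i + j + h)); intros e e' H; simpl; rewrite (H i) by lia.
    rewrite (H j) by lia; rewrite (H h) by lia; reflexivity.
  - exists (S (i + j + h)); intros e e' H; simpl; rewrite (H i) by lia.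
    rewrite (H j) by lia; rewrite (H h) by lia; reflexivity.
  - exists k1; intros e e' H; simpl; rewrite (IH e e' H); reflexivity.
  - exists (k1 + k2); intros e e' H; simpl.
    rewrite (IH1 e e'), (IH2 e e'); [reflexivity| |]; intros n Hn; apply H; lia.
  - exists k1; intros e e' H; simpl.
    assert (K : forall a, sat P lt M phi (upd e i a) <-> sat P lt M phi (upd e' i a)).
    { intros a; apply IH; intros n Hn; unfold upd.
      destruct (Nat.eqb n i); auto. }
    split; intros (a & Ha & Ka); exists a; (split; [exact Ha|]); apply K, Ka.
Qed.

Definition env (l : list V) (n : nat) : V := nth n l emp.

(** The Skolem functions of all formulas and all quantified variables at once. Without a witness the
    value is arbitrary, which does no harm to a closure. *)
Definition skolem P lt (N : V -> Prop) (l : list V) (z : V) : Prop :=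
  exists c : formula * nat, (True /\ True) /\
    z = eps (fun a => N a /\ sat P lt N (fst c) (upd (env l) (snd c) a)).

Lemma countable_skolem P lt N l : countable (skolem P lt N l).
Proof.
  apply (countable_iunion (fun c : formula * nat => True /\ True)).
  - apply (enum_prod _ _ enum_formula enum_nat).
  - intros c _; apply countable_eq.
Qed.

(** The Tarski-Vaught test. Atomic formulas have the same meaning in [M] and [N], so only the
    existential quantifier needs the closure. *)
Lemma elementary_skolem P lt N M : (exists x, x ∈ M) ->
  (forall x, x ∈ M -> N x) -> closed N (skolem P lt N) M -> elementary P lt N M.
Proof.
  intros HM MN CM; split; [exact HM|]; split; [exact MN|].
  induction phi as [i j|i j|i j|i|i j|i j h|i j h|phi IH|phi IH1 psi IH2|i phi IH];
    intros e He; simpl; try reflexivity.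
  - rewrite (IH e He); reflexivity.
  - rewrite (IH1 e He), (IH2 e He); reflexivity.
  - assert (U : forall a, a ∈ M -> forall n, upd e i a n ∈ M).
    { intros a Ha n; unfold upd; destruct (Nat.eqb n i); auto. }
    split.
    + intros (a & Ha & Sa); exists a; split; [apply MN, Ha|].
      apply IH; [apply U, Ha|exact Sa].
    + intros (a & Ha & Sa).
      destruct (sat_local P lt N phi) as [k Hk].
      pose (l := map e (seq 0 k)).
      assert (El : forall b, sat P lt N phi (upd (env l) i b) <->
        sat P lt N phi (upd e i b)).
      { intros b; apply Hk; intros n Hn; unfold upd.
        destruct (Nat.eqb n i); [reflexivity|].
        unfold env, l; rewrite nth_indep with (d' := e 0);
          [|rewrite length_map, length_seq; exact Hn].
        rewrite map_nth, seq_nth; [reflexivity|exact Hn]. }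
      destruct (eps_spec (fun a => N a /\ sat P lt N phi (upd (env l) i a)))
        as [B1 B2].
      { exists a; split; [exact Ha|apply El, Sa]. }
      set (b := eps _) in *; exists b.
      assert (Mb : b ∈ M).
      { apply (CM l b); [|exists (phi, i); split; [auto|reflexivity]|exact B1].
        apply Forall_forall; intros z Hz; apply in_map_iff in Hz.
        destruct Hz as (n & <- & _); apply He. }
      split; [exact Mb|]; apply IH; [apply U, Mb|apply El, B2].
Qed.

(** * Spanning implies semiproper *)

Lemma forces_eq_mono S p q a t : end_extends q p ->
  forces_eq (P_forcing S) p a t -> forces_eq (P_forcing S) q a t.
Proof.
  intros Hqp [H1 H2]; constructor.
  - intros pi s Hs r Hr Hrq; apply (H1 pi s Hs r Hr).
    apply end_extends_trans with q; assumption.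
  - intros pi s Hs r Hr Hrq; apply (H2 pi s Hs r Hr).
    apply end_extends_trans with q; assumption.
Qed.

Lemma P_cond_exists kappa S : omega1 ⊆ kappa -> stationary (elts kappa) S ->
  exists p, P_cond S p.
Proof.
  intros HO HS; destruct (proj2 HS (cl (elts kappa) (fun _ _ => False)))
    as (x & _ & Sx).
  { apply club_cl; [exact HO|]; intros _; exists (fun _ => 0); intros z w []. }
  exists (mkseq emp (snoc emp (fun _ => x) x)); apply P_cond_mkseq.
  - apply emp_omega1.
  - apply good_snoc.
    + apply omega1_ord, emp_omega1.
    + exact Sx.
    + intros b Hb; destruct (mem_emp b Hb).
    + intros b Hb; destruct (mem_emp b Hb).
    + intros (_ & (b & Hb) & _); destruct (mem_emp b Hb).
Qed.

Lemma small_P_cond kappa S : stationary (elts kappa) S -> small (P_cond S).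
Proof.
  intros HS; apply small_sub with (fun p => forall z, z ∈ p -> exists a v,
    a ∈ omega1 /\ v ⊆ kappa /\ z = pair a v).
  - intros p Hp z Hz; destruct (P_cond_inv S p Hp) as (O & Sp & G1 & _).
    apply Sp in Hz; destruct Hz as (a & Ha & ->); exists a, (at_ p a).
    split; [apply (le_omega1 a (len p)); assumption|]; split; [|reflexivity].
    intros z Hz; apply (proj1 HS _ (G1 a Ha)), Hz.
  - apply small_pow, small_image2; [apply small_elts|].
    apply (small_pow (elts kappa)), small_elts.
Qed.

(** The last members of conditions are countable and together cover ω1. *)
Lemma P_cond_uncountable kappa S : omega1 ⊆ kappa -> stationary (elts kappa) S ->
  ~ countable (P_cond S).
Proof.
  intros HO HS C; apply omega1_uncountable.
  apply countable_sub with (fun z => exists p, P_cond S p /\ z ∈ top p).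
  - intros z Hz; destruct (P_cond_exists kappa S HO HS) as [p Hp].
    destruct (add_spec kappa S p z HO HS Hp (HO z Hz)) as (A1 & _ & _ & A4); eauto.
  - apply countable_iunion; [apply countable_enumerable, C|].
    intros p Hp; exact (proj1 (proj2 (proj1 HS _ (top_S S p Hp)))).
Qed.

(** The pair [c] holds a deciding condition and the decided value. They are chosen together, so that
    a set closed under both components of [decide] contains the values that its conditions
    decide. *)
Definition decides S (tau p : V) (c : V * V) : Prop :=
  P_cond S (fst c) /\ end_extends (fst c) p /\ snd c ∈ omega1 /\
  exists t, is_check (P_forcing S) (snd c) t /\
    forces_eq (P_forcing S) (fst c) tau t.

Definition decide S (tau p : V) : V * V :=
  epsilon (inhabits (emp, emp)) (decides S tau p).

Lemma decide_spec S tau p : countable_ordinal_name (P_forcing S) tau ->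
  P_cond S p -> decides S tau p (decide S tau p).
Proof.
  intros (_ & w & [_ W] & H) Hp.
  refine (epsilon_spec (inhabits (emp, emp)) (decides S tau p) _).
  destruct (H p Hp p Hp (end_extends_refl S p Hp))
    as (r & Hr & Er & pi & s & Hs & _ & F).
  destruct (W _ Hs) as (b & t & u & Hb & Ht & _ & E).
  apply pair_inj in E; destruct E as [-> _].
  exists (r, b); split; [exact Hr|]; split; [exact Er|]; split; [exact Hb|]; eauto.
Qed.

Lemma semiproper_of_spanning kappa S : cardinal kappa -> omega1 ⊆ kappa ->
  stationary (elts kappa) S -> spanning kappa S -> semiproper (P_forcing S).
Proof.
  intros Ck HO HS Sp.
  pose proof (small_P_cond kappa S HS) as SP.
  destruct (cardinality_exists (P_cond S) SP) as (mu & Cmu).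
  exists mu; split; [exact Cmu|].
  assert (Omu : omega1 ⊆ mu).
  { destruct (ord_mem_or_incl mu omega1) as [H|H];
      [apply Cmu|apply ordinal_omega1| |exact H].
    destruct (P_cond_uncountable kappa S HO HS).
    apply injects_countable with (elts mu); [apply equinum_injects, Cmu|].
    apply omega1_countable, H. }
  split; [exact Omu|].
  intros nu lambda (_ & Hnu & _) Cl Hnl lt Hlt.
  assert (Ol : omega1 ⊆ lambda).
  { apply incl_trans with mu; [exact Omu|].
    exact (proj1 (proj1 Cl) mu (Hnl mu Hnu)). }
  (* Adjoining P_S and κ makes it unnecessary to check that conditions and elements of κ lie in H_λ.
     The submodels sought are the traces on H_λ. *)
  pose (A := fun z => Hset lambda z \/ P_cond S z \/ z ∈ kappa).
  assert (HA : forall z, z ∈ omega1 -> A z) by (intros z Hz; right; right; auto).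
  (* [G] collects what [fusion] demands of [N], together with the two components of [decide]. *)
  pose (G := fun l z => z = emp \/
    (exists p, l = [p] /\ (P_cond S p /\ z ∈ top p)) \/
    (exists p a, l = [p; a] /\ (z = add S p a \/
       z = fst (decide S a p) \/ z = snd (decide S a p)))).
  destruct (spanning_class kappa S A Ck HO) with (C := cl A G) as (D & CD & HD).
  { apply small_or; [apply small_Hset, Cl|].
    apply small_or; [exact SP|apply small_elts]. }
  { intros z Hz; right; right; exact Hz. }
  { exact Sp. }
  { apply club_cl; [exact HA|]; intros l.
    apply countable_or; [apply countable_eq|]; apply countable_or.
    - apply (countable_list1 (fun p z => P_cond S p /\ z ∈ top p)); intros p.
      destruct (classic (P_cond S p)) as [Hp|Hp].
      + apply countable_and; exact (proj1 (proj2 (proj1 HS _ (top_S S p Hp)))).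
      + exists (fun _ => 0); intros z w [K _]; contradiction.
    - apply (countable_list2 (fun p a z => z = add S p a \/
       z = fst (decide S a p) \/ z = snd (decide S a p))).
      intros p a; apply countable_or; [apply countable_eq|].
      apply countable_or; apply countable_eq. }
  destruct (club_contains_cl A D HA CD) as (G2 & HG2 & G2D).
  (* A set [M'] closed under [G2] lies in [D] and so has an extension [N]. Closure under [Sk] makes
     its trace on H_λ elementary. *)
  pose (Sk := fun l z => z = emp \/
    skolem (P_forcing S) lt (Hset lambda) l z).
  destruct (club_trace A (Hset lambda) (cl A (fun l z => G2 l z \/ Sk l z)))
    as (G3 & HG3 & T).
  { intros z Hz; apply Hset_omega1; assumption. }
  { intros z Hz; left; exact Hz. }
  { apply club_cl; [exact HA|]; intros l; apply countable_or; [apply HG2|].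
    apply countable_or; [apply countable_eq|apply countable_skolem]. }
  exists (cl (Hset lambda) G3); split.
  { apply club_cl; [|exact HG3]; intros z Hz; apply Hset_omega1; assumption. }
  intros M HM; destruct (T M HM) as (M' & HM' & E).
  apply cl_or in HM'; destruct HM' as [M1 [_ M2]]; apply closed_or in M2.
  destruct M2 as [M2 M3].
  assert (H0 : Hset lambda emp) by (apply Hset_omega1; auto using emp_omega1).
  split.
  { apply elementary_skolem.
    - exists emp; apply E; split; [|exact H0].
      apply (M2 [] emp); [constructor|reflexivity|left; exact H0].
    - intros x Hx; apply E, Hx.
    - intros l z Hl Hz Nz; apply E; split; [|exact Nz].
      apply (M3 l z); [|exact Hz|left; exact Nz].
      apply Forall_impl with (2 := Hl); intros w Hw; apply E, Hw. }
  intros p0 Hp0 Mp0.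
  destruct (HD M' (G2D M' M1)) as (N & [(N1 & N2 & N3) GN] & [MN dN] & SN).
  (* The n-th task decides the n-th element of [N] if it is a name for a countable ordinal. The
     enumeration [en N] may leave [N], hence the test for membership. *)
  pose (m := fun n p => if excluded_middle_informative
      (en N n ∈ N /\ countable_ordinal_name (P_forcing S) (en N n))
    then fst (decide S (en N n) p) else p).
  destruct (fusion kappa S (elts N) (cap N kappa) m p0) as (q & Q1 & Q2 & Q3);
    try assumption.
  { intros z; apply mem_cap. }
  { apply (GN [] emp); [constructor|left; reflexivity|left; exact H0]. }
  { apply MN, E, Mp0. }
  { intros p z Hp Np Hz; apply (GN [p]); [constructor; auto|right; left; eauto|].
    right; right; apply (proj1 HS _ (top_S S p Hp)), Hz. }
  { intros p a Hp Np Na Ka; apply (GN [p; a]).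
    - constructor; [exact Np|]; constructor; auto.
    - right; right; eauto.
    - right; left; apply (add_spec kappa); assumption. }
  { intros n p Hp Np; unfold m; destruct (excluded_middle_informative _) as [[Nn Cn]|_].
    - destruct (decide_spec S (en N n) p Cn Hp) as (D1 & D2 & _).
      split; [|split; assumption]; apply (GN [p; en N n]).
      + constructor; [exact Np|]; constructor; auto.
      + right; right; exists p, (en N n); auto.
      + right; left; exact D1.
    - split; [exact Np|]; split; [exact Hp|apply (end_extends_refl S), Hp]. }
  exists q; split; [exact Q1|]; split; [exact Q2|].
  intros a Ha Ca; assert (Na : a ∈ N) by apply MN, E, Ha.
  destruct (en_spec N a N2 Na) as [n En]; destruct (Q3 n) as (p & Np & Hp & Eq).
  unfold m in Eq; rewrite <- En in Eq.
  destruct (excluded_middle_informative _) as [_|X]; [|destruct X; auto].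
  destruct (decide_spec S a p Ca Hp) as (D1 & D2 & D3 & t & D4 & D5).
  set (b := snd (decide S a p)) in *.
  assert (Nb : b ∈ N).
  { apply (GN [p; a]).
    - constructor; [exact Np|]; constructor; auto.
    - right; right; exists p, a; auto.
    - right; right; apply HO, D3. }
  assert (Mb : b ∈ delta M') by (rewrite dN; apply mem_delta; auto).
  apply mem_delta in Mb.
  exists b, t; split; [apply E; split; [apply Mb|apply Hset_omega1; assumption]|].
  split; [exact D4|]; apply forces_eq_mono with (fst (decide S a p)); assumption.
Qed.

(** * Forced equality and check names *)

(** Induction along names, valid for all sets: [pi] lies in the transitive closure of [t]. The laws
    of forced equality can thus be proved without assuming that the arguments are names. *)
Lemma name_ind_mem (Q : V -> Prop) :
  (forall t, (forall pi s, pair pi s ∈ t -> Q pi) -> Q t) -> forall t, Q t.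
Proof.
  intros H t; induction (wf_clos_trans V mem mem_wf t) as [t _ IH].
  apply H; intros pi s Hs; apply IH.
  apply t_trans with (pair pi s); [|apply t_step, Hs].
  apply t_trans with (upair pi pi); apply t_step; apply mem_upair; auto.
Qed.

Lemma forces_eq_refl S p t : forces_eq (P_forcing S) p t t.
Proof.
  revert p; induction t as [t IH] using name_ind_mem; intros p.
  constructor; intros pi s Hs q Hq _; exists q; (split; [exact Hq|]);
    (split; [apply (end_extends_refl S), Hq|]); intros K; exists pi, s;
    split; [exact Hs| |exact Hs|]; (split; [exact K|apply (IH pi s Hs)]).
Qed.

Lemma forces_eq_sym S p t u :
  forces_eq (P_forcing S) p t u -> forces_eq (P_forcing S) p u t.
Proof.
  revert p u; induction t as [t IH] using name_ind_mem; intros p u [H1 H2].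
  constructor.
  - intros pi s Hs q Hq Eq; destruct (H2 pi s Hs q Hq Eq) as (r & Hr & Er & K).
    exists r; split; [exact Hr|]; split; [exact Er|]; intros L.
    destruct (K L) as (pi' & s' & Hs' & L' & F); exists pi', s'.
    split; [exact Hs'|]; split; [exact L'|]; apply (IH pi' s' Hs' _ _ F).
  - intros pi s Hs q Hq Eq; destruct (H1 pi s Hs q Hq Eq) as (r & Hr & Er & K).
    exists r; split; [exact Hr|]; split; [exact Er|]; intros L.
    destruct (K L) as (pi' & s' & Hs' & L' & F); exists pi', s'.
    split; [exact Hs'|]; split; [exact L'|]; apply (IH pi s Hs _ _ F).
Qed.

Lemma forces_eq_trans S p t u v : forces_eq (P_forcing S) p t u ->
  forces_eq (P_forcing S) p u v -> forces_eq (P_forcing S) p t v.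
Proof.
  revert p u v; induction t as [t IH] using name_ind_mem.
  intros p u v [H1 H2] [K1 K2]; constructor.
  - intros pi s Hs q Hq Eq; destruct (H1 pi s Hs q Hq Eq) as (r & Hr & Er & A).
    (* If [r] is not below [s], the implication to be proved at [r] is vacuous. *)
    destruct (classic (ext (P_forcing S) r s)) as [B|B];
      [|exists r; split; [exact Hr|split; [exact Er|contradiction]]].
    destruct (A B) as (pi' & s' & Hs' & B' & F).
    assert (Erp : end_extends r p) by (apply end_extends_trans with q; assumption).
    destruct (K1 pi' s' Hs' r Hr Erp) as (r' & Hr' & Er' & A').
    exists r'; split; [exact Hr'|].
    split; [apply end_extends_trans with r; assumption|]; intros _.
    destruct A' as (pi'' & s'' & Hs'' & B'' & F');
      [apply end_extends_trans with r; assumption|].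
    exists pi'', s''; split; [exact Hs''|]; split; [exact B''|].
    apply (IH pi s Hs r' pi' pi''); [|exact F'].
    apply forces_eq_mono with r; assumption.
  - intros pi s Hs q Hq Eq; destruct (K2 pi s Hs q Hq Eq) as (r & Hr & Er & A).
    destruct (classic (ext (P_forcing S) r s)) as [B|B];
      [|exists r; split; [exact Hr|split; [exact Er|contradiction]]].
    destruct (A B) as (pi' & s' & Hs' & B' & F).
    assert (Erp : end_extends r p) by (apply end_extends_trans with q; assumption).
    destruct (H2 pi' s' Hs' r Hr Erp) as (r' & Hr' & Er' & A').
    exists r'; split; [exact Hr'|].
    split; [apply end_extends_trans with r; assumption|]; intros _.
    destruct A' as (pi'' & s'' & Hs'' & B'' & F');
      [apply end_extends_trans with r; assumption|].
    exists pi'', s''; split; [exact Hs''|]; split; [exact B''|].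
    apply (IH pi'' s'' Hs'' r' pi' pi); [exact F'|].
    apply forces_eq_mono with r; assumption.
Qed.

Definition check S (x : V) : V := eps (is_check (P_forcing S) x).

Lemma check_spec S x : small (P_cond S) -> is_check (P_forcing S) x (check S x).
Proof.
  intros HS; refine (eps_spec (is_check (P_forcing S) x) _); induction (mem_wf x) as [x _ IH].
  assert (IH' : forall y, y ∈ x -> is_check (P_forcing S) y (check S y)).
  { intros y Hy; exact (eps_spec (is_check (P_forcing S) y) (IH y Hy)). }
  pose proof (mem_setof _ (small_image2 (fun y p => pair (check S y) p) (elts x)
    (P_cond S) (small_elts x) HS)) as E.
  set (t := setof _) in E; exists t; constructor.
  - intros y p Hy Hp; exists (check S y); split; [apply IH', Hy|].
    apply E; exists y, p; auto.
  - intros z Hz; apply E in Hz; destruct Hz as (y & p & Hy & Hp & ->).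
    exists y, (check S y), p; auto.
Qed.

Lemma check_unique S x t u : is_check (P_forcing S) x t ->
  is_check (P_forcing S) x u -> t = u.
Proof.
  revert t u; induction (mem_wf x) as [x _ IH].
  assert (K : forall t u, is_check (P_forcing S) x t -> is_check (P_forcing S) x u ->
    t ⊆ u).
  { intros t u [_ T] [U _] z Hz; destruct (T z Hz) as (y & s & p & Hy & Hs & Hp & ->).
    destruct (U y p Hy Hp) as (s' & Hs' & Hz').
    rewrite (IH y Hy s s' Hs Hs'); exact Hz'. }
  intros t u Ht Hu; apply incl_antisym; apply K; assumption.
Qed.

Lemma check_name S x t : is_check (P_forcing S) x t -> name (P_forcing S) t.
Proof.
  revert t; induction (mem_wf x) as [x _ IH]; intros t [_ T]; constructor.
  intros z Hz; destruct (T z Hz) as (y & s & p & Hy & Hs & Hp & ->).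
  exists s, p; split; [reflexivity|]; split; [apply (IH y Hy s Hs)|exact Hp].
Qed.

(** In a check name every condition is attached to every element, so [q] itself can be inserted into
    both clauses of forced equality. *)
Lemma forces_check_inj S q a b t u : P_cond S q -> is_check (P_forcing S) a t ->
  is_check (P_forcing S) b u -> forces_eq (P_forcing S) q t u -> a = b.
Proof.
  revert b q t u; induction (mem_wf a) as [a _ IH].
  intros b q t u Hq [T1 T2] [U1 U2] [H1 H2].
  apply incl_antisym; intros y Hy.
  - destruct (T1 y q Hy Hq) as (s & Hs & Ps).
    destruct (H1 s q Ps q Hq (end_extends_refl S q Hq)) as (r & Hr & Er & K).
    destruct (K Er) as (pi & s' & Hpi & _ & F).
    destruct (U2 _ Hpi) as (y' & w & p & Hy' & Hw & _ & E).
    apply pair_inj in E; destruct E as [-> _].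
    rewrite (IH y Hy y' r s w Hr Hs Hw F); exact Hy'.
  - destruct (U1 y q Hy Hq) as (s & Hs & Ps).
    destruct (H2 s q Ps q Hq (end_extends_refl S q Hq)) as (r & Hr & Er & K).
    destruct (K Er) as (pi & s' & Hpi & _ & F).
    destruct (T2 _ Hpi) as (y' & w & p & Hy' & Hw & _ & E).
    apply pair_inj in E; destruct E as [-> _].
    rewrite <- (IH y' Hy' y r w s Hr Hw Hs F); exact Hy'.
Qed.

(** * Dense partial functions as names *)

(** [dense_fun S b c]: [c] is the graph of a partial function on conditions,
    with open dense domain and values in [b] that do not change when the
    condition is strengthened.  Such a [c] stands for a name of an element
    of [b]. *)
Definition dense_fun S (b c : V) : Prop :=
  (forall z, z ∈ c -> exists p a, z = pair p a /\ P_cond S p /\ a ∈ b) /\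
  (forall p a a', pair p a ∈ c -> pair p a' ∈ c -> a = a') /\
  (forall p q a, pair p a ∈ c -> P_cond S q -> end_extends q p -> pair q a ∈ c) /\
  (forall p, P_cond S p ->
     exists q a, P_cond S q /\ end_extends q p /\ pair q a ∈ c).

(** The first conjunct bounds the class by a set of pairs, so that [setof] is not junk once the
    conditions form a set. *)
Definition graph S (b : V) (Phi : V -> V -> Prop) : V :=
  setof (fun z => (exists p a, P_cond S p /\ a ∈ b /\ z = pair p a) /\
    exists p a, Phi p a /\ z = pair p a).

Lemma mem_graph S b Phi p a : small (P_cond S) ->
  (pair p a ∈ graph S b Phi <-> P_cond S p /\ a ∈ b /\ Phi p a).
Proof.
  intros HS; unfold graph; rewrite mem_setof.
  - split.
    + intros [(p' & a' & Hp & Ha & E) (p'' & a'' & HPhi & E')].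
      apply pair_inj in E, E'; destruct E as [-> ->], E' as [-> ->]; auto.
    + intros (Hp & Ha & H); split; exists p, a; auto.
  - apply small_sub with (2 := small_image2 pair _ _ HS (small_elts b)).
    intros z [H _]; exact H.
Qed.

Lemma graph_sub S b Phi z : small (P_cond S) -> z ∈ graph S b Phi ->
  exists p a, z = pair p a /\ P_cond S p /\ a ∈ b.
Proof.
  intros HS Hz; unfold graph in Hz; rewrite mem_setof in Hz.
  - destruct Hz as [(p & a & Hp & Ha & E) _]; eauto.
  - apply small_sub with (2 := small_image2 pair _ _ HS (small_elts b)).
    intros w [H _]; exact H.
Qed.

Lemma dense_fun_graph S b Phi : small (P_cond S) ->
  (forall p a a', P_cond S p -> a ∈ b -> a' ∈ b -> Phi p a -> Phi p a' -> a = a') ->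
  (forall p q a, P_cond S p -> P_cond S q -> end_extends q p -> a ∈ b ->
     Phi p a -> Phi q a) ->
  (forall p, P_cond S p -> exists q a, P_cond S q /\ end_extends q p /\ a ∈ b /\
     Phi q a) ->
  dense_fun S b (graph S b Phi).
Proof.
  intros HS H1 H2 H3; split; [|split; [|split]].
  - intros z; apply graph_sub, HS.
  - intros p a a'; rewrite !mem_graph by exact HS.
    intros (Hp & Ha & K) (_ & Ha' & K'); eauto.
  - intros p q a; rewrite !mem_graph by exact HS.
    intros (Hp & Ha & K) Hq E; eauto.
  - intros p Hp; destruct (H3 p Hp) as (q & a & Hq & E & Ha & K); exists q, a.
    rewrite mem_graph by exact HS; auto.
Qed.

(** A genuine name for the value of [c]: an ordinal is the set of its predecessors, so the check
    name of [b] is put in with condition [q] whenever [b] is below the value of [c] at [q]. The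
    first conjunct again keeps the class small. *)
Definition fun_name S (c : V) : V :=
  setof (fun z => (exists b q, b ∈ omega1 /\ P_cond S q /\ z = pair (check S b) q) /\
    exists b q a, pair q a ∈ c /\ b ∈ a /\ z = pair (check S b) q).

Lemma mem_fun_name S c z : small (P_cond S) -> dense_fun S omega1 c ->
  (z ∈ fun_name S c <->
   exists b q a, pair q a ∈ c /\ b ∈ a /\ z = pair (check S b) q).
Proof.
  intros HS Hc; unfold fun_name; rewrite mem_setof.
  - split; [tauto|]; intros (b & q & a & Hq & Hb & ->); split; [|eauto 7].
    exists b, q; destruct (proj1 Hc _ Hq) as (p & a' & E & Hp & Ha).
    apply pair_inj in E; destruct E as [-> ->]; split; [|auto].
    exact (omega1_trans a' Ha b Hb).
  - apply small_sub with (2 := small_image2 (fun b q => pair (check S b) q) _ _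
      (small_elts omega1) HS).
    intros w [H _]; exact H.
Qed.

Lemma fun_name_value S c p a : small (P_cond S) -> dense_fun S omega1 c ->
  pair p a ∈ c -> forces_eq (P_forcing S) p (fun_name S c) (check S a).
Proof.
  intros HS Hc Hp; pose proof Hc as (_ & C2 & C3 & _).
  destruct (check_spec S a HS) as [T1 T2]; constructor.
  - intros pi s Hs q Hq Eq; exists q; split; [exact Hq|].
    split; [apply (end_extends_refl S), Hq|]; intros K.
    apply mem_fun_name in Hs; [|exact HS|exact Hc].
    destruct Hs as (b & q' & a' & Ha' & Hb & E); apply pair_inj in E.
    destruct E as [-> <-].
    (* [q] lies below both [p] and [q'], and [c] has only one value at [q]. *)
    assert (E : a' = a) by (apply (C2 q); apply C3 with (2 := Hq) in Ha'; eauto).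
    subst a'; destruct (T1 b q Hb Hq) as (s' & Hs' & Ps').
    exists s', q; split; [exact Ps'|].
    split; [apply (end_extends_refl S), Hq|].
    rewrite (check_unique S b s' (check S b) Hs' (check_spec S b HS)).
    apply forces_eq_refl.
  - intros pi s Hs q Hq Eq; exists q; split; [exact Hq|].
    split; [apply (end_extends_refl S), Hq|]; intros K.
    destruct (T2 _ Hs) as (b & s' & p' & Hb & Hs' & _ & E); apply pair_inj in E.
    destruct E as [-> _]; exists (check S b), q; split; [|split].
    + apply mem_fun_name; [exact HS|exact Hc|]; exists b, q, a.
      split; [apply (C3 p); assumption|auto].
    + apply (end_extends_refl S), Hq.
    + rewrite (check_unique S b s' (check S b) Hs' (check_spec S b HS)).
      apply forces_eq_refl.
Qed.

Lemma fun_name_ordinal S c : small (P_cond S) -> dense_fun S omega1 c ->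
  countable_ordinal_name (P_forcing S) (fun_name S c).
Proof.
  intros HS Hc; split.
  - constructor; intros z Hz; apply mem_fun_name in Hz; [|exact HS|exact Hc].
    destruct Hz as (b & q & a & Hq & _ & ->); exists (check S b), q.
    split; [reflexivity|]; split; [apply (check_name S b), check_spec, HS|].
    destruct (proj1 Hc _ Hq) as (p & a' & E & Hp & _).
    apply pair_inj in E; destruct E as [-> _]; exact Hp.
  - exists (check S omega1); split; [apply check_spec, HS|].
    intros p _ q Hq _; destruct (proj2 (proj2 (proj2 Hc)) q Hq) as (r & a & Hr & Er & Ha).
    exists r; split; [exact Hr|]; split; [exact Er|].
    destruct (check_spec S omega1 HS) as [T1 _].
    destruct (proj1 Hc _ Ha) as (p' & a' & E & _ & Oa).
    apply pair_inj in E; destruct E as [-> ->].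
    destruct (T1 a' p' Oa Hr) as (s & Hs & Ps); exists s, p'.
    split; [exact Ps|]; split; [apply (end_extends_refl S), Hr|].
    rewrite (check_unique S a' s (check S a') Hs (check_spec S a' HS)).
    apply fun_name_value; assumption.
Qed.

(** The form in which semigenericity is used: [r] forces the name to equal both the check name of
    [a] and that of some [b] in [M], so [a = b]. *)
Lemma semigeneric_value S M q c r a : small (P_cond S) ->
  semigeneric (P_forcing S) M q -> dense_fun S omega1 c -> fun_name S c ∈ M ->
  P_cond S r -> end_extends r q -> pair r a ∈ c -> a ∈ M.
Proof.
  intros HS Hq Hc HM Hr Er Ha.
  destruct (Hq _ HM (fun_name_ordinal S c HS Hc)) as (b & t & Mb & Ht & F).
  replace a with b; [exact Mb|]; symmetry.
  apply (forces_check_inj S r a b (check S a) t Hr (check_spec S a HS) Ht).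
  apply forces_eq_trans with (fun_name S c).
  - apply forces_eq_sym, fun_name_value; assumption.
  - apply forces_eq_mono with q; assumption.
Qed.

(** * Operations on dense functions *)

Definition const_fun S (l a : V) : V := graph S l (fun _ b => b = a).

Lemma dense_const_fun S l a : small (P_cond S) -> a ∈ l ->
  dense_fun S l (const_fun S l a).
Proof.
  intros HS Ha; apply dense_fun_graph; [exact HS|congruence|auto|].
  intros p Hp; exists p, a; split; [exact Hp|].
  split; [apply (end_extends_refl S), Hp|auto].
Qed.

(** Values outside ω1 are replaced by [emp], which yields a name for a countable ordinal, as
    semigenericity requires, from any [c] with values in λ. *)
Definition low_fun S (c : V) : V := graph S omega1 (fun p b =>
  exists a, pair p a ∈ c /\ ((a ∈ omega1 /\ b = a) \/ (~ a ∈ omega1 /\ b = emp))).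

Lemma dense_low_fun S l c : small (P_cond S) -> dense_fun S l c ->
  dense_fun S omega1 (low_fun S c).
Proof.
  intros HS (_ & C2 & C3 & C4); apply dense_fun_graph; [exact HS| | |].
  - intros p b b' _ _ _ (a & Ha & K) (a' & Ha' & K').
    rewrite (C2 p a' a Ha' Ha) in K'.
    destruct K as [[? ->]|[? ->]], K' as [[? ->]|[? ->]]; tauto.
  - intros p q b Hp Hq E _ (a & Ha & K); exists a; split; [|exact K].
    apply (C3 p); assumption.
  - intros p Hp; destruct (C4 p Hp) as (q & a & Hq & E & Ha).
    destruct (classic (a ∈ omega1)) as [K|K]; [exists q, a|exists q, emp];
      (split; [exact Hq|]); (split; [exact E|]).
    + split; [exact K|]; exists a; auto.
    + split; [apply emp_omega1|]; exists a; auto.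
Qed.

Definition first_index (p v a : V) : Prop :=
  le a (len p) /\ v ∈ at_ p a /\ forall b, b ∈ a -> ~ v ∈ at_ p b.

(** Stands for the first index at which the value of [c] enters the generic sequence. By
    semigenericity it will lie below δ_M. The default [emp] covers values outside κ. *)
Definition index_fun S (kappa c : V) : V := graph S omega1 (fun p a =>
  exists v, pair p v ∈ c /\
    ((v ∈ kappa /\ first_index p v a) \/ (~ v ∈ kappa /\ a = emp))).

Lemma dense_index_fun kappa S l c : omega1 ⊆ kappa -> stationary (elts kappa) S ->
  dense_fun S l c -> dense_fun S omega1 (index_fun S kappa c).
Proof.
  intros HO HS (_ & C2 & C3 & C4).
  apply dense_fun_graph; [apply (small_P_cond kappa), HS| | |].
  - intros p a a' _ Oa Oa' (v & Hv & K) (v' & Hv' & K').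
    rewrite (C2 p v' v Hv' Hv) in K'.
    destruct K as [[N (L & M & F)]|[N ->]], K' as [[N' (L' & M' & F')]|[N' ->]];
      try tauto.
    destruct (ord_trich a a' (omega1_ord a Oa) (omega1_ord a' Oa')) as [H|[H|H]];
      [|exact H|]; [destruct (F' a H M)|destruct (F a' H M')].
  - intros p q a Hp Hq E _ (v & Hv & K); exists v; split; [apply (C3 p); assumption|].
    destruct K as [[N (L & M & F)]|K]; [left|right; exact K].
    destruct (end_extends_inv q p E) as (Op & Oq & _ & Ea).
    split; [exact N|]; split; [|split].
    + apply le_trans_ord with (len p); [apply omega1_ord, Oq|exact L|].
      apply (ext_cond_le S); assumption.
    + rewrite (Ea a L); exact M.
    + intros b Hb; rewrite (Ea b); [apply F, Hb|].
      apply le_lt_trans with a; [apply omega1_ord, Op|exact L|exact Hb].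
  - intros p Hp; destruct (C4 p Hp) as (q & v & Hq & E & Hv).
    destruct (classic (v ∈ kappa)) as [K|K].
    + destruct (add_spec kappa S q v HO HS Hq K) as (A1 & A2 & _ & A4).
      pose proof (len_omega1 S _ A1) as Or; set (r := add S q v) in *.
      destruct (mem_min (fun a => le a (len r) /\ v ∈ at_ r a)) as (a & [La Ma] & Fa).
      { exists (len r); split; [right; reflexivity|exact A4]. }
      exists r, a; split; [exact A1|].
      split; [apply end_extends_trans with q; assumption|].
      split; [apply (le_omega1 a (len r)); assumption|].
      exists v; split; [apply (C3 q); assumption|]; left; split; [exact K|].
      split; [exact La|]; split; [exact Ma|]; intros b Hb Mb; apply (Fa b Hb).
      split; [|exact Mb].
      apply le_lt_trans with a; [apply omega1_ord, Or|exact La|exact Hb].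
    + exists q, emp; split; [exact Hq|]; split; [exact E|].
      split; [apply emp_omega1|]; exists v; auto.
Qed.

(** Needed because [en] may enumerate more than the set in question; the default keeps values in
    [l]. *)
Definition into (l b : V) : V := if excluded_middle_informative (b ∈ l) then b else emp.

Lemma into_mem l b : emp ∈ l -> into l b ∈ l.
Proof. intros H; unfold into; destruct (excluded_middle_informative _); auto. Qed.

Lemma into_id l b : b ∈ l -> b = into l b.
Proof.
  intros H; unfold into; destruct (excluded_middle_informative _); tauto.
Qed.

(** Stands for the n-th term in an enumeration of the a-th entry of the generic sequence. *)
Definition member_fun S (l a : V) (n : nat) : V :=
  graph S l (fun p b => le a (len p) /\ b = into l (en (at_ p a) n)).

Lemma dense_member_fun kappa S l a n : omega1 ⊆ kappa ->
  stationary (elts kappa) S -> emp ∈ l -> a ∈ omega1 ->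
  dense_fun S l (member_fun S l a n).
Proof.
  intros HO HS L0 Oa; apply dense_fun_graph; [apply (small_P_cond kappa), HS| | |].
  - intros p b b' _ _ _ [_ ->] [_ ->]; reflexivity.
  - intros p q b Hp Hq E _ [L ->].
    destruct (end_extends_inv q p E) as (Op & Oq & _ & Ea).
    split; [|rewrite (Ea a L); reflexivity].
    apply le_trans_ord with (len p); [apply omega1_ord, Oq|exact L|].
    apply (ext_cond_le S); assumption.
  - intros p Hp.
    destruct (len_dense kappa S (succ a) p HO HS (succ_omega1 a Oa) Hp)
      as (q & Hq & E & La).
    exists q, (into l (en (at_ q a) n)); split; [exact Hq|]; split; [exact E|].
    split; [apply into_mem, L0|]; split; [|reflexivity].
    left; apply La, mem_succ; auto.
Qed.

(** Stands for the n-th element of [G] at the values of the functions in [cs]; it makes the set of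
    decided values closed under [G]. *)
Definition image_fun S (l : V) (G : list V -> V -> Prop) (n : nat) (cs : list V) : V :=
  graph S l (fun p b => exists bs, Forall2 (fun c v => pair p v ∈ c) cs bs /\
    b = into l (en (setof (G bs)) n)).

Lemma dense_image_fun S l G n cs : small (P_cond S) -> emp ∈ l ->
  Forall (dense_fun S l) cs -> dense_fun S l (image_fun S l G n cs).
Proof.
  intros HS L0 Hcs.
  assert (Up : forall p q bs cs, Forall (dense_fun S l) cs -> P_cond S q ->
    end_extends q p -> Forall2 (fun c v => pair p v ∈ c) cs bs ->
    Forall2 (fun c v => pair q v ∈ c) cs bs).
  { clear; intros p q bs cs Hcs Hq E H; induction H as [|c v cs bs Hv _ IH];
      constructor; inversion Hcs as [|? ? (_ & _ & C3 & _)]; subst; eauto. }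
  apply dense_fun_graph; [exact HS| | |].
  - intros p b b' _ _ _ (bs & H & ->) (bs' & H' & ->).
    replace bs' with bs; [reflexivity|]; revert bs' H'.
    induction H as [|c v cs bs Hv _ IH]; intros bs' H'; inversion H'; subst; auto.
    inversion Hcs as [|? ? (_ & C2 & _)]; subst; f_equal; eauto.
  - intros p q b Hp Hq E _ (bs & H & ->); exists bs; split; [|reflexivity].
    apply (Up p); assumption.
  - intros p Hp.
    assert (K : exists q bs, P_cond S q /\ end_extends q p /\
      Forall2 (fun c v => pair q v ∈ c) cs bs).
    { induction Hcs as [|c cs Hc Hcs (q & bs & Hq & E & H)].
      - exists p, []; split; [exact Hp|].
        split; [apply (end_extends_refl S), Hp|constructor].
      - destruct (proj2 (proj2 (proj2 Hc)) q Hq) as (r & v & Hr & E' & Hv).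
        exists r, (v :: bs); split; [exact Hr|].
        split; [apply end_extends_trans with q; assumption|].
        constructor; [exact Hv|]; apply (Up q); assumption. }
    destruct K as (q & bs & Hq & E & H).
    exists q, (into l (en (setof (G bs)) n)); split; [exact Hq|].
    split; [exact E|]; split; [apply into_mem, L0|]; exists bs; auto.
Qed.

(** * Semiproper implies spanning *)

Lemma decide_all kappa S l (M q : V) : omega1 ⊆ kappa -> stationary (elts kappa) S ->
  countable (elts M) -> P_cond S q ->
  exists r, P_cond S r /\ end_extends r q /\
    forall c, c ∈ M -> dense_fun S l c -> exists a, pair r a ∈ c.
Proof.
  intros HO HS CM Hq.
  pose (Q := fun n p r => P_cond S r /\ end_extends r p /\
    exists a, pair r a ∈ en M n).
  pose (m := fun n p => if excluded_middle_informative (dense_fun S l (en M n))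
    then eps (Q n p) else p).
  assert (Hm : forall n p, P_cond S p ->
    (P_cond S (m n p) /\ end_extends (m n p) p) /\
    (dense_fun S l (en M n) -> exists a, pair (m n p) a ∈ en M n)).
  { intros n p Hp; unfold m; destruct (excluded_middle_informative _) as [D|D].
    - destruct (eps_spec (Q n p)) as (Q1 & Q2 & Q3); [|auto].
      destruct (proj2 (proj2 (proj2 D)) p Hp) as (r & a & Hr & E & Ha).
      exists r; split; [exact Hr|]; split; [exact E|eauto].
    - split; [split; [exact Hp|apply (end_extends_refl S), Hp]|contradiction]. }
  destruct (distributive kappa S m q HO HS Hq) as (r & R1 & R2 & R3).
  { intros n p Hp; apply Hm, Hp. }
  exists r; split; [exact R1|]; split; [exact R2|]; intros c Hc Dc.
  destruct (en_spec M c CM Hc) as [n En]; destruct (R3 n) as (p & Hp & E).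
  rewrite En in *; destruct (proj2 (Hm n p Hp) Dc) as [a Ha]; exists a.
  apply (proj1 (proj2 (proj2 Dc)) (m n p)); assumption.
Qed.

(** [p0] is a condition at which semiproperness can be applied. [emp] and [succ] make δ_M a limit,
    [const_fun] gives M ∩ λ ⊆ y, [low_fun] gives δ_y = δ_M, [index_fun] and [member_fun] give the
    two inclusions between y ∩ κ and the δ_M-th entry, and [image_fun] gives closure under [G]. *)
Definition name_closure S (kappa l p0 : V) (G : list V -> V -> Prop)
    (cs : list V) (z : V) : Prop :=
  (z = emp \/ z = p0) \/
  (exists a, cs = [a] /\ ((z = succ a \/ z = const_fun S l a) \/
     (z = fun_name S (low_fun S a) \/ z = fun_name S (index_fun S kappa a)) \/
     exists n, z = member_fun S l a n)) \/
  exists n, z = image_fun S l G n cs.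

Lemma countable_name_closure S kappa l p0 G cs :
  countable (name_closure S kappa l p0 G cs).
Proof.
  apply countable_or; [apply countable_or; apply countable_eq|].
  apply countable_or; [|apply countable_seq].
  apply (countable_list1 (fun a z => (z = succ a \/ z = const_fun S l a) \/
    (z = fun_name S (low_fun S a) \/ z = fun_name S (index_fun S kappa a)) \/
    exists n, z = member_fun S l a n)).
  intros a; apply countable_or; [apply countable_or; apply countable_eq|].
  apply countable_or; [|apply countable_seq].
  apply countable_or; apply countable_eq.
Qed.

(* The values decided by [r] for the dense functions in [M] play the role of
   [M[H]], for [H] a generic filter containing [r]. *)
Lemma decided_values kappa S l G (A : V -> Prop) M p0 q :
  omega1 ⊆ kappa -> kappa ⊆ l -> stationary (elts kappa) S ->
  (forall bs, countable (G bs)) ->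
  (forall z, z ∈ l -> A z) -> A p0 ->
  (forall c, (forall z, z ∈ c -> exists p a, z = pair p a /\ P_cond S p /\ a ∈ l) ->
     A c /\ A (fun_name S c)) ->
  ctbl A M -> closed A (name_closure S kappa l p0 G) M ->
  P_cond S q -> semigeneric (P_forcing S) M q ->
  exists y, cl (elts l) G y /\ omega1_extension (cap M l) y /\ S (cap y kappa).
Proof.
  intros HO HK HS HG Al A0 Afun (M1 & M2 & M3) M4 Hq Sq.
  pose proof (small_P_cond kappa S HS) as SP.
  assert (Ol : omega1 ⊆ l) by (apply incl_trans with kappa; assumption).
  assert (L0 : emp ∈ l) by apply Ol, emp_omega1.
  assert (Agraph : forall b Phi, b ⊆ l ->
    A (graph S b Phi) /\ A (fun_name S (graph S b Phi))).
  { intros b Phi Hb; apply Afun; intros z Hz.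
    destruct (graph_sub S b Phi z SP Hz) as (p & a & E & Hp & Ha); eauto 6. }
  set (d := delta M) in *.
  assert (Hd : forall a, a ∈ d <-> a ∈ M /\ a ∈ omega1) by apply mem_delta.
  assert (Ld : limit d).
  { split; [apply omega1_ord, M3|]; split.
    - exists emp; apply Hd; split; [|apply emp_omega1].
      apply (M4 [] emp); [constructor|left; auto|apply Al, L0].
    - intros b Hb; apply Hd in Hb; destruct Hb as [Mb Ob]; exists (succ b).
      split; [apply Hd; split; [|apply succ_omega1, Ob]|apply mem_succ; auto].
      apply (M4 [b]); [constructor; auto|right; left; eauto 7|].
      apply Al, Ol, succ_omega1, Ob. }
  destruct (decide_all kappa S l M q HO HS M2 Hq) as (q1 & Q1 & E1 & Dec1).
  destruct (len_dense kappa S d q1 HO HS M3 Q1) as (r & R1 & E2 & Ldr).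
  assert (Er : end_extends r q) by (apply end_extends_trans with q1; assumption).
  assert (Dec : forall c, c ∈ M -> dense_fun S l c -> exists a, pair r a ∈ c).
  { intros c Hc Dc; destruct (Dec1 c Hc Dc) as [a Ha]; exists a.
    apply (proj1 (proj2 (proj2 Dc)) q1); assumption. }
  pose proof (len_omega1 S r R1) as Or.
  assert (Lr : le d (len r)).
  { apply ord_le_incl; [apply omega1_ord, M3|apply omega1_ord, Or|exact Ldr]. }
  pose proof (P_good S r R1) as Gr.
  pose (Y := fun b => exists c, c ∈ M /\ (dense_fun S l c /\ pair r b ∈ c)).
  assert (CY : countable Y).
  { apply countable_iunion; [apply countable_enumerable, M2|].
    (* Each [c] contributes at most one value at [r]. *)
    intros c _; apply countable_sub with (fun b => b = eps (fun b => pair r b ∈ c));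
      [|apply countable_eq].
    intros b [Dc Hb]; apply (proj1 (proj2 Dc) r); [exact Hb|].
    apply (eps_spec (fun b => pair r b ∈ c)); eauto. }
  pose proof (mem_setof Y (small_countable Y CY)) as Hy.
  set (y := setof Y) in Hy.
  assert (Yl : y ⊆ l).
  { intros b Hb; apply Hy in Hb; destruct Hb as (c & _ & Dc & Hb).
    destruct (proj1 Dc _ Hb) as (p & a & E & _ & Ha).
    apply pair_inj in E; destruct E as [_ ->]; exact Ha. }
  assert (My : cap M l ⊆ y).
  { intros b Hb; apply mem_cap in Hb; destruct Hb as [Mb Lb].
    apply Hy; exists (const_fun S l b); split; [|split].
    - apply (M4 [b]); [constructor; auto|right; left; eauto 7|].
      apply Agraph, incl_refl.
    - apply dense_const_fun; assumption.
    - apply mem_graph; auto. }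
  assert (Yd : forall b, b ∈ y -> b ∈ omega1 -> b ∈ M).
  { intros b Hb Ob; apply Hy in Hb; destruct Hb as (c & Mc & Dc & Hb).
    pose proof (dense_low_fun S l c SP Dc) as DL.
    apply (semigeneric_value S M q (low_fun S c) r b); try assumption.
    - apply (M4 [c]); [constructor; auto|right; left; eauto 7|].
      apply Agraph, Ol.
    - apply mem_graph; [exact SP|]; split; [exact R1|]; split; [exact Ob|].
      exists b; auto. }
  assert (Yk : cap y kappa = at_ r d).
  { apply set_ext; intros b; rewrite mem_cap; split.
    - intros [Hb Kb]; apply Hy in Hb; destruct Hb as (c & Mc & Dc & Hb).
      pose proof (dense_index_fun kappa S l c HO HS Dc) as DI.
      (* [r] need not decide the first index, but an extension [s] does. The index is in [M] by
         semigenericity, hence below [d], where [s] and [r] agree. *)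
      destruct (proj2 (proj2 (proj2 DI)) r R1) as (s & a & Hs & Es & Ha).
      assert (Ma : a ∈ M).
      { apply (semigeneric_value S M q (index_fun S kappa c) s a); try assumption.
        - apply (M4 [c]); [constructor; auto|right; left; eauto 7|].
          apply Agraph, Ol.
        - apply end_extends_trans with r; assumption. }
      apply mem_graph in Ha; [|exact SP]; destruct Ha as (_ & Oa & v & Hv & F).
      assert (Ev : v = b).
      { apply (proj1 (proj2 Dc) s); [exact Hv|].
        apply (proj1 (proj2 (proj2 Dc)) r); assumption. }
      subst v; destruct F as [[_ (_ & F & _)]|[N _]]; [|contradiction].
      assert (Had : a ∈ d) by (apply Hd; auto).
      assert (Lar : le a (len r)).
      { apply le_lt_trans with d; [apply omega1_ord, Or|exact Lr|exact Had]. }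
      destruct (end_extends_inv s r Es) as (_ & _ & _ & Eat).
      rewrite (Eat a Lar) in F.
      exact (good_mono S (len r) (at_ r) a d Gr Lr (or_introl Had) b F).
    - intros Hb; pose proof (proj1 Gr d Lr) as Sd.
      assert (Kb : b ∈ kappa) by apply (proj1 HS _ Sd), Hb.
      split; [|exact Kb].
      (* Continuity at the limit [d] moves [b] to an entry whose index is in [M]. *)
      apply (proj2 (proj2 Gr) d Lr Ld) in Hb; destruct Hb as (a & Ha & Hb).
      assert (Lar : le a (len r)).
      { apply le_lt_trans with d; [apply omega1_ord, Or|exact Lr|exact Ha]. }
      destruct (en_spec (at_ r a) b) as [n En]; [|exact Hb|].
      { exact (proj1 (proj2 (proj1 HS _ (proj1 Gr a Lar)))). }
      apply Hd in Ha; destruct Ha as [Ma Oa].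
      apply Hy; exists (member_fun S l a n); split; [|split].
      + apply (M4 [a]); [constructor; auto|right; left; eauto 7|].
        apply Agraph, incl_refl.
      + apply (dense_member_fun kappa); assumption.
      + apply mem_graph; [exact SP|]; split; [exact R1|]; split; [apply HK, Kb|].
        split; [exact Lar|]; rewrite <- En; apply into_id, HK, Kb. }
  assert (Ey : delta (cap M l) = delta y).
  { apply delta_ext; intros z Oz; split; [apply My|]; intros Hz.
    apply mem_cap; split; [apply Yd; assumption|apply Ol, Oz]. }
  exists y; split; [split; [split; [|split]|]|split; [split|]].
  - exact Yl.
  - apply countable_sub with (2 := CY); intros z; apply Hy.
  - rewrite <- Ey, (delta_ext _ M); [exact M3|]; intros z Oz; rewrite mem_cap.
    split; [tauto|]; intros Hz; split; [exact Hz|apply Ol, Oz].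
  - intros bs z Hbs Gz Lz.
    assert (K : exists cs, Forall (elts M) cs /\ Forall (dense_fun S l) cs /\
      Forall2 (fun c v => pair r v ∈ c) cs bs).
    { clear Gz; induction Hbs as [|b bs Hb _ (cs & C1 & C2 & C3)].
      - exists []; auto.
      - apply Hy in Hb; destruct Hb as (c & Mc & Dc & Hb); exists (c :: cs); auto. }
    destruct K as (cs & C1 & C2 & C3).
    pose proof (mem_setof _ (small_countable _ (HG bs))) as EG.
    destruct (en_spec (setof (G bs)) z) as [n En]; [|apply EG, Gz|].
    { apply countable_sub with (2 := HG bs); intros w; apply EG. }
    apply Hy; exists (image_fun S l G n cs); split; [|split].
    + apply (M4 cs); [exact C1|right; right; eauto|].
      apply Agraph, incl_refl.
    + apply dense_image_fun; assumption.
    + apply mem_graph; [exact SP|]; split; [exact R1|]; split; [exact Lz|].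
      exists bs; split; [exact C3|]; rewrite <- En; apply into_id, Lz.
  - exact My.
  - exact Ey.
  - rewrite Yk; apply (proj1 Gr d Lr).
Qed.

Lemma spanning_of_semiproper kappa S : omega1 ⊆ kappa ->
  stationary (elts kappa) S -> semiproper (P_forcing S) -> spanning kappa S.
Proof.
  intros HO HS (mu & Cmu & Omu & Sp) l Cl HK C CC.
  assert (Ol : omega1 ⊆ l) by (apply incl_trans with kappa; assumption).
  pose proof (small_P_cond kappa S HS) as SP.
  destruct (club_contains_cl (elts l) C Ol CC) as (G & HG & GC).
  destruct (card_succ_exists mu) as [nu Hnu]; [apply Cmu|].
  pose (pl := fun z => exists p a, P_cond S p /\ a ∈ l /\ z = pair p a).
  (* What H_t has to contain: the elements of λ, the conditions, every possible graph of a dense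
     function and the name built from it. *)
  pose (W := fun z => z ∈ l \/ P_cond S z \/
    exists c, (forall z, z ∈ c -> pl z) /\ (z = c \/ z = fun_name S c)).
  destruct (Hset_above W nu) as (t & Ct & Hnt & HW).
  { apply small_or; [apply small_elts|]; apply small_or; [exact SP|].
    apply (small_bigunion (fun c => forall z, z ∈ c -> pl z)
      (fun c z => z = c \/ z = fun_name S c)).
    - apply small_pow, small_image2; [exact SP|apply small_elts].
    - intros c; apply small_or; apply small_eq. }
  { apply Hnu. }
  destruct (well_orders_exist (Hset t) (small_Hset t Ct)) as [lt Hlt].
  destruct (Sp nu t Hnu Ct Hnt lt Hlt) as (E & CE & HE).
  assert (Al : forall z, z ∈ l -> Hset t z) by (intros z Hz; apply HW; left; auto).
  assert (Ao : forall z, z ∈ omega1 -> Hset t z) by auto.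
  destruct (club_contains_cl (Hset t) E Ao CE) as (GE & HGE & GEE).
  destruct (P_cond_exists kappa S HO HS) as [p0 Hp0].
  (* [D] consists of sets [x] that are traces on λ of sets [M] lying in the club from semiproperness
     and closed under [name_closure]. *)
  destruct (club_trace (Hset t) (elts l) (cl (Hset t)
    (fun cs z => GE cs z \/ name_closure S kappa l p0 G cs z))) as (G3 & HG3 & T).
  { exact Ol. }
  { exact Al. }
  { apply club_cl; [exact Ao|]; intros cs; apply countable_or; [apply HGE|].
    apply countable_name_closure. }
  exists (cl (elts l) G3); split; [apply club_cl; assumption|].
  intros x Hx; destruct (T x Hx) as (M & HM & EM); apply cl_or in HM.
  destruct HM as [ME [M1 M2]].
  assert (A0 : Hset t p0) by (apply HW; right; left; exact Hp0).
  assert (Mp0 : p0 ∈ M) by (apply (M2 [] p0); [constructor|left; auto|exact A0]).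
  destruct (proj2 (HE M (GEE M ME)) p0 Hp0 Mp0) as (q & Hq & _ & Sq).
  destruct (decided_values kappa S l G (Hset t) M p0 q) as (y & Y1 & Y2 & Y3);
    try assumption.
  { intros c Hc; split; apply HW; right; right; exists c; (split; [|auto]);
      intros z Hz; destruct (Hc z Hz) as (p & a & -> & Hp & Ha); exists p, a; auto. }
  replace x with (cap M l); [exists y; auto|].
  apply set_ext; intros z; rewrite mem_cap, (EM z); reflexivity.
Qed.

Theorem theorem4p4 (kappa omega2 : V) (S : V -> Prop)
  (homega2 : card_succ omega1 omega2)
  (hkappa : cardinal kappa) (hkappa2 : omega2 ⊆ kappa)
  (hS : stationary (elts kappa) S) :
  spanning kappa S <-> semiproper (P_forcing S).
Proof.
  assert (HO : omega1 ⊆ kappa).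
  { destruct homega2 as (_ & H & _).
    exact (proj1 (proj1 hkappa) omega1 (hkappa2 omega1 H)). }
  split.
  - apply semiproper_of_spanning; assumption.
  - apply spanning_of_semiproper; assumption.
Qed.
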